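(* Let $F:[0,\tau]\times L^2(\Omega)\to L^2(\Omega)$ satisfy: there exists $\kappa>0$ such that $\|F(s,\psi_1)-F(s,\psi_2)\|\le\kappa\|\psi_1-\psi_2\|$ for all $s\in[0,\tau]$ and $\psi_1,\psi_2\in L^2(\Omega)$; and there exists $\phi\in L^2(\Omega)$ such that $s\mapsto F(s,\phi)\in L^1(0,\tau;L^2(\Omega))$. Let $g\in L^2(\Omega)$ and let $u\in C([0,\tau];L^2(\Omega))$ be the unique solution of the final value problem $$u_t-\Delta u=F(t,u)+\int_t^\tau u(x,s)\,ds\ \text{ in }\Omega\times(0,\tau),\qquad u=0\ \text{ on }\partial\Omega\times(0,\tau),\qquad u(\cdot,\tau)=g\ \text{ in }\Omega.$$ Let $\delta>0$ and let $g^\delta\in L^2(\Omega)$ satisfy $\|g^\delta-g\|\le\delta$. Let $p,q>0$ and $\kappa_0=\max\{\kappa,1\}$. For $N\in\mathbb{N}$, let $u^N_\delta\in C([0,\tau];L^2(\Omega))$ be the unique element satisfying $$u^N_\delta(t)=\mathcal{S}_N(\tau-t)g^\delta-\int_t^\tau\mathcal{S}_N(s-t)F(s,u^N_\delta(s))\,ds-\int_t^\tau\mathcal{S}_N(s-t)\int_s^\tau u^N_\delta(\xi)\,d\xi\,ds,\qquad 0\le t\le\tau.$$ Then the following hold: (i) If $u\in L^\infty(0,\tau;\mathbb{G}_{p,\tau})$, then for $0\le t\le\tau$ $$\|u(t)-u^N_\delta(t)\|\le e^{(1+\kappa_0)(\tau-t)}\,\|u\|_{L^\infty(0,\tau;\mathbb{G}_{p,\tau})}\,\lambda_N^{-p}e^{-\lambda_N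 t}+\delta\,e^{\lambda_N(\tau-t)}e^{(1+\kappa_0)(\tau-t)}.$$ (ii) If $u\in L^\infty(0,\tau;\mathbb{G}_{0,q+\tau})$, then for $0\le t\le\tau$ $$\|u(t)-u^N_\delta(t)\|\le e^{(1+\kappa_0)(\tau-t)}\,\|u\|_{L^\infty(0,\tau;\mathbb{G}_{0,q+\tau})}\,e^{-(q+t)\lambda_N}+\delta\,e^{\lambda_N(\tau-t)}e^{(1+\kappa_0)(\tau-t)}.$$
   Context: $\Omega\subset\mathbb{R}^d$ ($d\ge1$) is a bounded domain with smooth boundary, $\tau>0$ is fixed; $\langle\cdot,\cdot\rangle$ and $\|\cdot\|$ are the inner product and norm of $L^2(\Omega)$. $0<\lambda_1\le\lambda_2\le\cdots\to\infty$ are the eigenvalues of the Dirichlet problem $-\Delta v=\lambda v$ in $\Omega$, $v=0$ on $\partial\Omega$, with eigenfunctions $\varphi_j\in H^1_0(\Omega)\cap H^2(\Omega)$ forming an orthonormal basis of $L^2(\Omega)$. For $N\in\mathbb{N}$ and $t\in[0,\tau]$, $\mathcal{S}_N(t):L^2(\Omega)\to L^2(\Omega)$ is defined by $\mathcal{S}_N(t)\psi=\sum_{j=1}^N e^{\lambda_j t}\langle\psi,\varphi_j\rangle\varphi_j$. For $a,b\ge0$, the Gevrey space is $\mathbb{G}_{a,b}=\{\psi\in L^2(\Omega):\sum_{j=1}^\infty\lambda_j^{2a}e^{2b\lambda_j}|\langle\psi,\varphi_j\rangle|^2<\infty\}$, a Hilbert space with norm $\|\psi\|_{\mathbb{G}_{a,b}}^2=\sum_{j=1}^\infty\lambda_j^{2a}e^{2b\lambda_j}|\langle\psi,\varphi_j\rangle|^2$.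 $L^\infty(0,\tau;\mathbb{G}_{a,b})$ carries the usual essential supremum norm. Standing assumption: the final value problem has a unique solution $u\in C([0,\tau];L^2(\Omega))$ for the exact final value $g$. Its coefficients $u_j(t)=\langle u(t),\varphi_j\rangle$ satisfy, for all $j\in\mathbb{N}$ and $t\in[0,\tau]$, $$u_j(t)=e^{\lambda_j(\tau-t)}\langle g,\varphi_j\rangle-\int_t^\tau e^{\lambda_j(s-t)}\langle F(s,u(s)),\varphi_j\rangle\,ds-\int_t^\tau e^{\lambda_j(s-t)}\int_s^\tau u_j(\xi)\,d\xi\,ds .$$ *)

(* Defs.v *)
From HB Require Import structures.
From mathcomp Require Import all_boot all_order all_algebra.
From mathcomp Require Import all_classical all_reals all_analysis ess_sup_inf.
Set Implicit Arguments.
Unset Strict Implicit.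
Unset Printing Implicit Defensive.
Import Order.TTheory GRing.Theory Num.Theory numFieldNormedType.Exports.
Local Open Scope classical_set_scope.
Local Open Scope ring_scope.

Definition rV_display : measure_display.
Proof. exact: default_measure_display. Qed.

Section measurable_rV.
Variables (R : realType) (n : nat).

Let coord (i : 'I_n) (x : 'rV[R]_n) : R := x ord0 i.

(* The sigma-algebra generated by the coordinates is the Borel one, see
   open_measurable_rV below. *)
HB.instance Definition _ := @isMeasurable.Build rV_display 'rV[R]_n
  (g_sigma_preimage coord) (@sigma_algebra0 _ _ _) (@sigma_algebraC _ _)
  (@sigma_algebra_bigcup _ _ _).

Lemma measurable_coord_rV (i : 'I_n) :
  measurable_fun [set: 'rV[R]_n] (fun x => x ord0 i).
Proof.
move=> _ Y mY; rewrite setTI; apply: sub_sigma_algebra => /=.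
rewrite -bigcup_seq/=; exists i => /=; first by rewrite mem_index_enum.
by exists Y => //; rewrite setTI.
Qed.

Lemma measurable_fun_rV d (T : measurableType d) (f : T -> 'rV[R]_n) :
  (forall i, measurable_fun [set: T] (fun x => f x ord0 i)) ->
  measurable_fun [set: T] f.
Proof.
move=> mf _ A; rewrite setTI => sA.
pose G := [set B : set 'rV[R]_n | measurable (f @^-1` B)].
suff: G A by [].
apply: sA; split; first split.
- by rewrite /G/= preimage_set0.
- by move=> B; rewrite /G/= setTD preimage_setC; exact: measurableC.
- by move=> F mF; rewrite /G/= preimage_bigcup; apply: bigcup_measurable => k _;
    exact: mF.
rewrite -bigcup_seq => B [i _ [Y mY <-]]; rewrite /G/= setTI.
by have := mf i measurableT _ mY; rewrite setTI.
Qed.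

Lemma open_measurable_rV (U : set 'rV[R]_n) : open U -> measurable U.
Proof.
move=> oU.
pose c (q : 'rV[rat]_n) : 'rV[R]_n := \row_i ratr (q ord0 i).
pose I := [set p : 'rV[rat]_n * nat | ball (c p.1) p.2.+1%:R^-1 `<=` U].
suff -> : U = \bigcup_(p in I) ball (c p.1) p.2.+1%:R^-1.
  rewrite bigcup_mkcond; apply: countable_bigcupT_measurable => [|[q k] /=].
    exact: countableP.
  case: ifP => // _.
  have k0 : 0 < k.+1%:R^-1 :> R by rewrite invr_gt0.
  have -> : ball (c q) k.+1%:R^-1 =
      \bigcap_(i in [set: 'I_n])
        ((fun x : 'rV[R]_n => x ord0 i) @^-1` ball (c q ord0 i) k.+1%:R^-1).
    apply/seteqP; split=> [x [_ xb] i _|x xb]; first exact: xb.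
    by split=> // i j; rewrite (ord1 i); exact: xb.
  apply: fin_bigcap_measurable => [|i _]; first exact: finite_finset.
  have := measurable_coord_rV i measurableT
    (measurable_realfun.open_measurable (ball_open (c q ord0 i) k.+1%:R^-1)).
  by rewrite setTI.
apply/seteqP; split=> [x Ux|x [p Ip /Ip]//].
have /nbhs_ballP[e /= e0 eU] : nbhs x U by exact: open_nbhs_nbhs.
have [k ke] : exists k : nat, k.+1%:R^-1 < e / 2.
  have [k _ /(_ _ (leqnn k)) ke] :=
    near_infty_natSinv_lt (PosNum (divr_gt0 e0 (ltr0n _ 2))).
  by exists k.
have k0 : 0 < k.+1%:R^-1 :> R by rewrite invr_gt0.
have /choice[q qx] : forall i : 'I_n, exists q : rat,
    ball (x ord0 i) k.+1%:R^-1 (ratr q : R).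
  move=> i; have := rat_in_itvoo (_ : x ord0 i - k.+1%:R^-1 < x ord0 i + k.+1%:R^-1).
  case; first by rewrite ltrBlDr -addrA ltrDl addr_gt0.
  move=> q; rewrite in_itv/= => /andP[h1 h2]; exists q.
  by rewrite /ball/= ltr_distlC h1 h2.
exists (\row_i q i, k) => /=.
  move=> y [_ yb]; apply: eU; split=> // i j.
  rewrite (splitr e) (ord1 i); apply: (@ball_triangle _ _ (c (\row_i q i) ord0 j)).
    by rewrite !mxE; apply: le_ball (qx j); exact: ltW.
  by apply: le_ball (yb ord0 j); exact: ltW.
by split=> // i j; rewrite (ord1 i); apply: ball_sym; rewrite !mxE.
Qed.

End measurable_rV.

Section lebesgue_rV.
Variable R : realType.

Definition cons_rV n (p : 'rV[R]_n * measurableTypeR R) : 'rV[R]_n.+1 :=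
  row_mx (const_mx p.2 : 'rV[R]_1) p.1.

Lemma measurable_cons_rV n : measurable_fun [set: _] (@cons_rV n).
Proof.
apply: measurable_fun_rV => i; rewrite /cons_rV.
case: (split_ordP (i : 'I_(1 + n))) => j ->.
  rewrite [X in measurable_fun _ X](_ : _ = snd); first exact: measurable_snd.
  apply/funext => x.
  exact: etrans (row_mxEl (const_mx x.2) x.1 ord0 j) (mxE _ _ _ _).
rewrite [X in measurable_fun _ X](_ : _ = fun x : 'rV[R]_n * _ => x.1 ord0 j).
  exact: (measurableT_comp (measurable_coord_rV j) measurable_fst).
by apply/funext => x; exact: (row_mxEr (const_mx x.2) x.1 ord0 j).
Qed.

Section lebesgue_rV_succ.
Variables (n : nat) (m : {measure set 'rV[R]_n -> \bar R}).

Definition lebesgue_rV_succ : set 'rV[R]_n.+1 -> \bar R :=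
  pushforward (m \x @lebesgue_measure R)%E (@cons_rV n).

HB.instance Definition _ := Measure.copy lebesgue_rV_succ
  (measure_function_pushforward__canonical__measure_function_Measure
    (m \x @lebesgue_measure R)%E (@measurable_cons_rV n)).

End lebesgue_rV_succ.

(* lebesgue_rV n.+1 is the image of lebesgue_rV n \x lebesgue_measure under
   the identification (y, a) |-> (a, y) of R^n x R with R^n.+1. *)
Fixpoint lebesgue_rV n : {measure set 'rV[R]_n -> \bar R} :=
  if n is m.+1 then lebesgue_rV_succ (lebesgue_rV m) else \d_(0 : 'rV[R]_0).

End lebesgue_rV.

Section smooth.
Variables (R : realType) (n : nat).
Implicit Types (f : 'rV[R]_n -> R) (Omega : set 'rV[R]_n).

Definition partial (i : 'I_n) f : 'rV[R]_n -> R := 'D_(delta_mx ord0 i) f.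

Definition iter_partial (s : seq 'I_n) f : 'rV[R]_n -> R := foldr partial f s.

Definition smooth f := forall s : seq 'I_n,
  continuous (iter_partial s f) /\
  forall (i : 'I_n) x, derivable (iter_partial s f) x (delta_mx ord0 i).

Definition test_function Omega f := [/\ smooth f,
  compact (closure [set x | f x != 0]) &
  closure [set x | f x != 0] `<=` Omega].

(* For an open set, closure Omega `\` Omega is the boundary; near each of its
   points Omega is the sublevel set of a smooth function with nonzero gradient. *)
Definition smooth_boundary Omega := forall x, (closure Omega `\` Omega) x ->
  exists (U : set 'rV[R]_n) (rho : 'rV[R]_n -> R),
    [/\ nbhs x U, smooth rho, exists i, partial i rho x != 0 &
        Omega `&` U = [set y | rho y < 0] `&` U].

Record smooth_bounded_domain := SmoothBoundedDomain {
  dom :> set 'rV[R]_n;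
  dom_open : open dom;
  dom_connected : connected dom;
  dom_nonempty : dom !=set0;
  dom_bounded : bounded_set dom;
  dom_smooth : smooth_boundary dom }.

End smooth.

(* V is a space of functions, not of classes, hence N is a seminorm; N takes
   the value +oo outside of the normed space under consideration. *)
Section bochner.
Variables (R : realType) (V : lmodType R) (N : V -> \bar R).
Local Notation leb := (@lebesgue_measure R).

Record simple_function := SimpleFunction {
  sf_size : nat;
  sf_set : 'I_sf_size -> set (measurableTypeR R);
  sf_val : 'I_sf_size -> V;
  sf_measurable : forall i, measurable (sf_set i);
  sf_finite : forall i, (leb (sf_set i) < +oo)%E;
  sf_norm : forall i, (N (sf_val i) < +oo)%E }.

Definition sf_fun (s : simple_function) (t : R) : V :=
  \sum_(i < sf_size s) (\1_(sf_set i) t : R) *: sf_val i.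

Definition sf_integral (D : set R) (s : simple_function) : V :=
  \sum_(i < sf_size s) fine (leb (sf_set i `&` D)) *: sf_val i.

Definition strongly_measurable (D : set R) (f : R -> V) :=
  exists s : nat -> simple_function,
    {ae leb, forall t, D t -> N (f t - sf_fun (s k) t) @[k --> \oo] --> 0%E}.

Definition bochner_integrable (D : set R) (f : R -> V) :=
  strongly_measurable D f /\ (\int[leb]_(t in D) N (f t) < +oo)%E.

Definition is_bochner_integral (D : set R) (f : R -> V) (v : V) :=
  strongly_measurable D f /\
  exists s : nat -> simple_function,
    (\int[leb]_(t in D) N (f t - sf_fun (s k) t))%E @[k --> \oo] --> 0%E /\
    N (sf_integral D (s k) - v) @[k --> \oo] --> 0%E.

End bochner.

Section L2.
Variables (R : realType) (n : nat) (Omega : smooth_bounded_domain R n).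

Definition lebesgue_dom : {measure set 'rV[R]_n -> \bar R} :=
  mrestr (lebesgue_rV R n) (open_measurable_rV (@dom_open _ _ Omega)).

Local Notation mu := lebesgue_dom.

(* Elements are square-integrable functions, not classes: equality in the
   Hilbert space L^2(Omega) is u = v %[ae lebesgue_dom Omega]. *)
Definition L2 := LfunType mu (lee1n 2).

Definition L2norm (v : L2) : R := fine 'N[mu]_(2%:R%:E)[EFin \o v].

Definition L2edist (f g : 'rV[R]_n -> R) : \bar R :=
  'N[mu]_(2%:R%:E)[EFin \o (f \- g)%R].

Definition inner (v w : L2) : R := \int[mu]_x (v x * w x).

Definition is_weak_partial (i : 'I_n) (v w : L2) :=
  forall eta, test_function Omega eta ->
    \int[mu]_x (v x * partial i eta x) = - \int[mu]_x (w x * eta x).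

(* H^1_0 is the closure of the test functions in H^1. *)
Definition in_H10 (v : L2) :=
  exists (G : 'I_n -> L2) (eta : nat -> 'rV[R]_n -> R),
    [/\ forall i, is_weak_partial i v (G i),
        forall k, test_function Omega (eta k),
        L2edist (eta k) v @[k --> \oo] --> 0%E &
        forall i, L2edist (partial i (eta k)) (G i) @[k --> \oo] --> 0%E].

(* v belongs to H^2 and h is its Laplacian. *)
Definition H2_laplacian (v h : L2) :=
  exists (G : 'I_n -> L2) (H : 'I_n -> 'I_n -> L2),
    [/\ forall i, is_weak_partial i v (G i),
        forall i j, is_weak_partial j (G i) (H i j) &
        h = \sum_i H i i %[ae mu]].

Definition dirichlet_eigenpair (l : R) (v : L2) :=
  in_H10 v /\ exists2 h, H2_laplacian v h & - h = l *: v %[ae mu].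

(* Sequences are indexed from 1; the values at index 0 are irrelevant.
   Completeness of phi makes lambda list all the eigenvalues, repeated
   according to their multiplicities. *)
Record dirichlet_eigenbasis (lambda : nat -> R) (phi : nat -> L2) : Prop := {
  eigen_pos : 0 < lambda 1;
  eigen_le : forall i j, (1 <= i <= j)%N -> lambda i <= lambda j;
  eigen_cvg : lambda j @[j --> \oo] --> +oo;
  eigen_pair : forall j, (1 <= j)%N -> dirichlet_eigenpair (lambda j) (phi j);
  eigen_orthonormal : forall i j, (1 <= i)%N -> (1 <= j)%N ->
    inner (phi i) (phi j) = (i == j)%:R;
  eigen_complete : forall psi : L2,
    L2norm (psi - \sum_(1 <= j < N.+1) inner psi (phi j) *: phi j)
      @[N --> \oo] --> 0 }.

Definition L2enorm (v : L2) : \bar R := (L2norm v)%:E.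

Definition continuous_L2 (tau : R) (u : R -> L2) := forall t, t \in `[0, tau] ->
  L2norm (u s - u t) @[s --> within `[0, tau] (nbhs t)] --> 0.

(* The functions u satisfying P form a single element of C([0,tau]; L^2). *)
Definition unique_in_CL2 (tau : R) (P : (R -> L2) -> Prop) (u : R -> L2) :=
  P u /\ forall v, P v -> forall t, t \in `[0, tau] -> v t = u t %[ae mu].

Local Notation leb := (@lebesgue_measure R).

(* Weak solutions: the equation is tested against v in the domain of the
   Dirichlet Laplacian and integrated over (t, tau). As the Laplacian is moved
   to v, this is meaningful for u in C([0,tau]; L^2), and the boundary condition
   is encoded by testing with all of H^2 /\ H^1_0. *)
Definition fvp_solution (tau : R) (F : R -> L2 -> L2) (g : L2) (u : R -> L2) :=
  [/\ continuous_L2 tau u,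
      bochner_integrable L2enorm `]0, tau[ (fun s => F s (u s)),
      u tau = g %[ae mu] &
      forall v h, in_H10 v -> H2_laplacian v h ->
      forall t, t \in `[0, tau] ->
        inner (u tau) v - inner (u t) v =
        \int[leb]_(s in `[t, tau])
          (inner (u s) h + inner (F s (u s)) v +
           \int[leb]_(xi in `[s, tau]) inner (u xi) v)].

Section spectral.
Variables (lambda : nat -> R) (phi : nat -> L2).

(* When F(., u(.)) is in L^1(0, tau; L^2), the integrands are almost everywhere
   equal to Borel functions, but they need not be Borel themselves. *)
Definition coefficient_formula (tau : R) (F : R -> L2 -> L2) (g : L2)
    (u : R -> L2) :=
  forall j t, (1 <= j)%N -> t \in `[0, tau] ->
    inner (u t) (phi j) =
      expR (lambda j * (tau - t)) * inner g (phi j)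
      - \int[leb]_(s in `[t, tau])
          (expR (lambda j * (s - t)) * inner (F s (u s)) (phi j))
      - \int[leb]_(s in `[t, tau])
          (expR (lambda j * (s - t)) *
           \int[leb]_(xi in `[s, tau]) inner (u xi) (phi j)).

Definition truncated_semigroup (N : nat) (t : R) (psi : L2) : L2 :=
  \sum_(1 <= j < N.+1) (expR (lambda j * t) * inner psi (phi j)) *: phi j.

Local Notation S := truncated_semigroup.

Definition regularized_solution (tau : R) (F : R -> L2 -> L2) (g : L2)
    (N : nat) (u : R -> L2) :=
  continuous_L2 tau u /\
  forall t, t \in `[0, tau] ->
  exists (J : R -> L2) (I1 I2 : L2),
    [/\ forall s, s \in `[t, tau] ->
          is_bochner_integral L2enorm `]s, tau[ u (J s),
        is_bochner_integral L2enorm `]t, tau[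
          (fun s => S N (s - t) (F s (u s))) I1,
        is_bochner_integral L2enorm `]t, tau[ (fun s => S N (s - t) (J s)) I2 &
        u t = S N (tau - t) g - I1 - I2 %[ae mu]].

(* The space G_(a, b) is the set where this extended norm is finite. *)
Definition gevrey_norm (a b : R) (psi : L2) : \bar R :=
  sqrte (\sum_(1 <= j <oo)
    (lambda j `^ (2 * a) * expR (2 * b * lambda j)
     * `|inner psi (phi j)| ^+ 2)%:E)%E.

Definition Linf_gevrey_enorm (tau a b : R) (u : R -> L2) : \bar R :=
  ess_sup (mrestr leb (@measurable_itv R `]0, tau[))
    (fun t => gevrey_norm a b (u t)).

Definition in_Linf_gevrey (tau a b : R) (u : R -> L2) :=
  strongly_measurable (gevrey_norm a b) `]0, tau[ u /\
  (Linf_gevrey_enorm tau a b u < +oo)%E.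

Definition Linf_gevrey_norm (tau a b : R) (u : R -> L2) : R :=
  fine (Linf_gevrey_enorm tau a b u).

End spectral.

End L2.

(* Main.v *)
(* Testing the coefficient formulas of u and of u^N_delta against
   P_N (u - u^N_delta)(t), where P_N is the projection onto the first N
   eigenfunctions, bounds ||P_N (u - u^N_delta)(t)|| by the noise and by
   integrals of ||u - u^N_delta||; the rest of the error is the tail of u, which
   the Gevrey norm controls.  With z(t) = e^(lambda_N t) ||u(t) - u^N_delta(t)||
   this reads
     z(t) <= A + int_t^tau kappa z + int_t^tau int_s^tau z.
   Instead of Gronwall's lemma, let m be a maximum point of z / y on [0, tau],
   with y(t) = e^((1 + kappa0) (tau - t)), and M the maximum: the integrals at m
   are at most M (y(m) - 1), whence M y(m) <= A + M (y(m) - 1), i.e. M <= A.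

   The integrands in time are only almost everywhere equal to Borel functions;
   [ae_integrable] expresses this, and Bochner integrals are used only through
   their inner products with the eigenfunctions. *)
Require Import Defs.
From HB Require Import structures.
From mathcomp Require Import all_boot all_order all_algebra.
From mathcomp Require Import all_classical all_reals all_analysis.
From mathcomp Require Import measurable_realfun ess_sup_inf ring lra.
Set Implicit Arguments.
Unset Strict Implicit.
Unset Printing Implicit Defensive.
Import Order.TTheory GRing.Theory Num.Theory numFieldNormedType.Exports.
Local Open Scope classical_set_scope.
Local Open Scope ring_scope.

(** * The inner product of L^2 *)

Section L2_hilbert.
Context (R : realType) (d : nat) (Omega : smooth_bounded_domain R d).
Implicit Types v w : L2 Omega.
Local Notation mu := (lebesgue_dom Omega).

Lemma integrable_L2_mul v w : mu.-integrable setT (EFin \o (v \* w)%R).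
Proof. by apply/Lfun1_integrable/Lfun2_mul_Lfun1; exact: LfunP. Qed.

Lemma innerC v w : inner v w = inner w v.
Proof. by apply: eq_Rintegral => x _; rewrite mulrC. Qed.

Lemma innerDl v1 v2 w : inner (v1 + v2) w = inner v1 w + inner v2 w.
Proof.
rewrite /inner -RintegralD//; [|exact: integrable_L2_mul..].
by apply: eq_Rintegral => x _; rewrite -mulrDl.
Qed.

Lemma innerZl a v w : inner (a *: v) w = a * inner v w.
Proof.
rewrite /inner -RintegralZl//; last exact: integrable_L2_mul.
by apply: eq_Rintegral => x _; rewrite mulrA.
Qed.

Lemma innerNl v w : inner (- v) w = - inner v w.
Proof. by rewrite -scaleN1r innerZl mulN1r. Qed.

Lemma innerBl v1 v2 w : inner (v1 - v2) w = inner v1 w - inner v2 w.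
Proof. by rewrite innerDl innerNl. Qed.

Lemma inner0l w : inner 0 w = 0.
Proof. by rewrite -(scale0r (0 : L2 Omega)) innerZl mul0r. Qed.

Lemma innerZr a v w : inner v (a *: w) = a * inner v w.
Proof. by rewrite innerC innerZl innerC. Qed.

Lemma inner_suml I (r : seq I) (f : I -> L2 Omega) w :
  inner (\sum_(i <- r) f i) w = \sum_(i <- r) inner (f i) w.
Proof.
by elim/big_rec2: _ => [|i x v _ <-]; rewrite ?inner0l ?innerDl.
Qed.

Lemma inner_sumr I (r : seq I) (f : I -> L2 Omega) w :
  inner w (\sum_(i <- r) f i) = \sum_(i <- r) inner w (f i).
Proof. by rewrite innerC inner_suml; apply: eq_bigr => i _; rewrite innerC. Qed.

(** Equations in [L2] hold only almost everywhere; this turns them into equations between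
    scalars. *)
Lemma inner_aeeq v1 v2 w : v1 = v2 %[ae mu] -> inner v1 w = inner v2 w.
Proof.
move=> v12; rewrite /inner /Rintegral; congr fine; apply: ae_eq_integral => //.
- by have /integrableP[] := integrable_L2_mul v1 w.
- by have /integrableP[] := integrable_L2_mul v2 w.
- by apply: filterS v12 => x /(_ I) v12 _; rewrite v12.
Qed.

Lemma L2norm_ge0 v : 0 <= L2norm v.
Proof. by rewrite fine_ge0// Lnorm_ge0. Qed.

Lemma L2norm_sqr v : L2norm v ^+ 2 = inner v v.
Proof.
rewrite -(powR_mulrn 2 (L2norm_ge0 v)); apply: EFin_inj.
rewrite -poweR_EFin /L2norm finite_norm_fine powR_Lnorm//.
rewrite /inner /Rintegral fineK; last first.
  by apply: (@integrable_fin_num _ _ _ mu setT); last exact: integrable_L2_mul.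
apply: eq_integral => x _.
by rewrite /= powR_mulrn// -normrX expr2 ger0_norm// -expr2 sqr_ge0.
Qed.

Lemma ler_L2normD v w : L2norm (v + w) <= L2norm v + L2norm w.
Proof. exact: ler_LnormD. Qed.

Lemma L2normZ a v : L2norm (a *: v) = `|a| * L2norm v.
Proof.
by rewrite /L2norm (LnormZ v a) -finite_norm_fine.
Qed.

Lemma L2normN v : L2norm (- v) = L2norm v.
Proof. by rewrite -scaleN1r L2normZ normrN1 mul1r. Qed.

Lemma cauchy_schwarz v w : `|inner v w| <= L2norm v * L2norm w.
Proof.
rewrite -lee_fin EFinM /L2norm !finite_norm_fine.
have mf (f : L2 Omega) : measurable_fun setT f by [].
apply: le_trans (@hoelder _ _ _ mu _ _ 2 2 (mf v) (mf w) _ _ _) => //; last first.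
  by rewrite [RHS]splitr !div1r.
rewrite Lnorm1 EFin_normr_Rintegral//; last exact: integrable_L2_mul.
by apply: le_abse_integral => //; have /integrableP[] := integrable_L2_mul v w.
Qed.

Lemma ler_L2norm_dist v w : `|L2norm v - L2norm w| <= L2norm (v - w).
Proof.
have le_dist (a b : L2 Omega) : L2norm a - L2norm b <= L2norm (a - b).
  by rewrite lerBlDr; have := ler_L2normD (a - b) b; rewrite subrK.
by rewrite ler_norml le_dist andbT lerNl opprB -(L2normN (v - w)) opprB le_dist.
Qed.

End L2_hilbert.

(** * Integrals of almost everywhere measurable functions *)

Section ae_integral.
Import HBNNSimple.
Context d (T : measurableType d) (R : realType).
Variable mu : {measure set T -> \bar R}.
Local Open Scope ereal_scope.

(** No measurability is assumed: the integral of a nonnegative function is a supremum over the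
    simple functions below it. Such a function below [f], set to zero on a null set that contains
    the exceptional points, lies below [g] and keeps its integral. *)
Lemma ge0_ae_le_integral (D : set T) (f g : T -> \bar R) :
  (forall x, D x -> 0 <= f x) -> (forall x, D x -> 0 <= g x) ->
  {ae mu, forall x, D x -> f x <= g x} ->
  \int[mu]_(x in D) f x <= \int[mu]_(x in D) g x.
Proof.
move=> f0 g0 [A [mA A0 fg]].
rewrite (ge0_integralE _ f0) (ge0_integralE _ g0).
apply: ge_ereal_sup => _ [h hf <-]; apply: ereal_sup_ubound => /=.
exists (mul_nnsfun h (indic_nnsfun R (measurableC mA))) => [x|].
  rewrite /= mindicE; have [xA|xA] := boolP (x \in ~` A); last first.
    by rewrite mulr0 /patch; case: ifPn => // /set_mem /g0.
  rewrite mulr1; apply: (le_trans (hf x)); rewrite /patch; case: ifPn => // xD.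
  apply: contrapT => nfg; move/set_mem : xA; apply; apply: fg => /=.
  by move=> /(_ (set_mem xD)).
have mEFin (k : {nnsfun T >-> R}) : measurable_fun setT (EFin \o k).
  by apply/measurable_EFinP.
rewrite -!integralT_nnsfun; apply: ge0_ae_eq_integral.
- exact: measurableT.
- exact: mEFin.
- exact: mEFin.
- by move=> x _; rewrite lee_fin.
- by move=> x _; rewrite lee_fin.
exists A; split => // x /= /not_implyP[_ nx]; apply: contrapT => xA; apply: nx.
by rewrite /= mindicE mem_set// mulr1.
Qed.

(* The integral of a nonnegative function is a supremum over the measurable
   simple functions below it, hence insensitive to null sets even when the
   function is not measurable. *)
Lemma ae_eq_integral_nonmeasurable (D : set T) (f g : T -> \bar R) :
  ae_eq mu D f g -> \int[mu]_(x in D) f x = \int[mu]_(x in D) g x.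
Proof.
move=> fg; rewrite integralE [RHS]integralE.
by congr (_ - _); apply/eqP; rewrite eq_le; apply/andP; split;
  apply: ge0_ae_le_integral => //; apply: filterS fg => x fg Dx;
  rewrite ?funeposE ?funenegE fg.
Qed.

End ae_integral.

(** * Integrability up to modification on a null set *)

Section ae_integrable.
Context d (T : measurableType d) (R : realType).
Variable mu : {measure set T -> \bar R}.
Variables (D : set T) (mD : measurable D).
Implicit Types f g h : T -> R.

Definition ae_integrable f :=
  exists2 h, mu.-integrable D (EFin \o h) & ae_eq mu D f h.

Lemma ae_eq_Rintegral f g : ae_eq mu D f g ->
  \int[mu]_(x in D) f x = \int[mu]_(x in D) g x.
Proof.
move=> fg; congr fine; apply: ae_eq_integral_nonmeasurable.
by apply: filterS fg => x fg Dx; rewrite fg.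
Qed.

Lemma integrable_ae_integrable f :
  mu.-integrable D (EFin \o f) -> ae_integrable f.
Proof. by move=> fi; exists f => //; apply: aeW. Qed.

Lemma eq_ae_integrable f g : {in D, f =1 g} -> ae_integrable f -> ae_integrable g.
Proof.
move=> fg [h ih fh]; exists h => //; apply: filterS fh => x fh Dx.
by rewrite -fg ?inE// fh.
Qed.

Lemma ae_integrableD f g : ae_integrable f -> ae_integrable g ->
  ae_integrable (fun x => f x + g x).
Proof.
move=> [f' if' ff'] [g' ig' gg']; exists (fun x => f' x + g' x).
  exact: (integrableD mD if' ig').
by apply: filterS2 ff' gg' => x ff' gg' Dx; rewrite ff'// gg'.
Qed.

Lemma ae_integrableZ a f : ae_integrable f ->
  ae_integrable (fun x => a * f x).
Proof.
move=> [f' if' ff']; exists (fun x => a * f' x); first exact: (integrableZl mD a if').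
by apply: filterS ff' => x ff' Dx; rewrite ff'.
Qed.

Lemma ae_RintegralD f g : ae_integrable f -> ae_integrable g ->
  \int[mu]_(x in D) (f x + g x) =
  \int[mu]_(x in D) f x + \int[mu]_(x in D) g x.
Proof.
move=> [f' if' ff'] [g' ig' gg'].
rewrite (ae_eq_Rintegral ff') (ae_eq_Rintegral gg') -RintegralD//.
apply: ae_eq_Rintegral.
by apply: filterS2 ff' gg' => x ff' gg' Dx; rewrite ff'// gg'.
Qed.

Lemma ae_RintegralZ a f : ae_integrable f ->
  \int[mu]_(x in D) (a * f x) = a * \int[mu]_(x in D) f x.
Proof.
move=> [f' if' ff']; rewrite (ae_eq_Rintegral ff') -RintegralZl//.
by apply: ae_eq_Rintegral; apply: filterS ff' => x ff' Dx; rewrite ff'.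
Qed.

(** Integrability and value are proved together, since the induction needs the former to split the
    integral. The predicate [P] confines the integrability hypothesis to a range of indices. *)
Lemma ae_integrable_sum I (r : seq I) (P : pred I) (c : I -> R) (f : I -> T -> R) :
  (forall i, P i -> ae_integrable (f i)) ->
  ae_integrable (fun x => \sum_(i <- r | P i) c i * f i x) /\
  \int[mu]_(x in D) (\sum_(i <- r | P i) c i * f i x) =
  \sum_(i <- r | P i) c i * \int[mu]_(x in D) f i x.
Proof.
move=> fi; elim: r => [|i r [IH1 IH2]].
  under eq_fun do rewrite big_nil.
  split; first exact/integrable_ae_integrable/integrable0.
  by rewrite big_nil Rintegral_cst// mul0r.
rewrite big_cons; under eq_fun do rewrite big_cons.
case: ifPn => // Pi; have cfi := ae_integrableZ (c i) (fi _ Pi).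
by split; [exact: ae_integrableD|rewrite ae_RintegralD// ae_RintegralZ ?IH2//; exact: fi].
Qed.

Lemma ae_le_normr_Rintegral f g : ae_integrable f ->
  mu.-integrable D (EFin \o g) -> {ae mu, forall x, D x -> `|f x| <= g x} ->
  `|\int[mu]_(x in D) f x| <= \int[mu]_(x in D) g x.
Proof.
move=> [f' if' ff'] ig fg; rewrite (ae_eq_Rintegral ff').
apply: le_trans (le_normr_Rintegral mD if') _.
(* The hypothesis makes [g] nonnegative only almost everywhere, whereas the comparison of integrals
   wants functions that are nonnegative on all of [D]. *)
have ige : \int[mu]_(x in D) g x = \int[mu]_(x in D) `|g x|.
  apply: ae_eq_Rintegral; apply: filterS fg => x fg Dx.
  by rewrite ger0_norm// (le_trans _ (fg Dx)).
have fin_int (h : T -> R) : mu.-integrable D (EFin \o h) ->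
    (\int[mu]_(x in D) (`|h x|)%:E \is a fin_num)%E.
  by move=> /integrable_norm ih; exact: integrable_fin_num.
rewrite ige; apply: fine_le; rewrite ?fin_int//.
apply: ge0_ae_le_integral => //; apply: filterS2 ff' fg => x ff' fg Dx.
by rewrite lee_fin -ff'// (le_trans (fg Dx)) ?ler_norm.
Qed.

End ae_integrable.

(** The integrable representative on [D], extended by zero, is one on [D']. *)
Lemma ae_integrable_setD_null d (T : measurableType d) (R : realType)
    (mu : {measure set T -> \bar R}) (D D' : set T) (f : T -> R) :
  measurable D -> measurable D' -> D `<=` D' -> mu (D' `\` D) = 0%E ->
  ae_integrable mu D f ->
  ae_integrable mu D' f /\ \int[mu]_(x in D) f x = \int[mu]_(x in D') f x.
Proof.
move=> mD mD' DD' D0 [h ih fh].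
have ip : mu.-integrable D' (EFin \o (h \_ D)).
  apply: (@integrableS _ _ _ _ setT) => //.
  by rewrite -restrict_EFin; apply/(integrable_mkcond _ mD).
have nD : {ae mu, forall x, ~ (D' `\` D) x}.
  by exists (D' `\` D); split => // [|x /contrapT//]; exact: measurableD.
have fp : ae_eq mu D' f (h \_ D).
  apply: filterS2 nD fh => x nD fh D'x.
  have Dx : D x by apply: contrapT => nDx; exact: nD.
  by rewrite patchE mem_set//= fh.
split; first by exists (h \_ D).
rewrite (ae_eq_Rintegral fh) (ae_eq_Rintegral fp) -Rintegral_mkcondr.
by rewrite setIidr.
Qed.

(** * Bochner integrals *)

(** In the applications [G] is the norm of a vector-valued function, whose measurability is not
    established. The constant is therefore moved to the other side: [C^-1 * h] is compared with [G],
    and linearity of the integral is applied to [f] only. *)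
Lemma ae_dominated_integrable d (T : measurableType d) (R : realType)
    (mu : {measure set T -> \bar R}) (D : set T) (mD : measurable D)
    (f h G : T -> R) (C : R) : 0 < C ->
  measurable_fun D h -> ae_eq mu D f h ->
  (forall x, D x -> `|f x| <= C * G x) ->
  (\int[mu]_(x in D) (G x)%:E < +oo)%E ->
  ae_integrable mu D f /\
  `|\int[mu]_(x in D) f x| <= C * \int[mu]_(x in D) G x.
Proof.
move=> C0 mh fh fG Goo.
have G0 x : D x -> 0 <= G x.
  by move=> Dx; rewrite -(pmulr_rge0 _ C0) (le_trans _ (fG x Dx)).
have le_int : (\int[mu]_(x in D) `|(C^-1 * h x)%:E| <= \int[mu]_(x in D) (G x)%:E)%E.
  apply: ge0_ae_le_integral => //; apply: filterS fh => x fh Dx.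
  rewrite -fh//= lee_fin normrM gtr0_norm ?invr_gt0//.
  by rewrite -ler_pdivlMl ?invr_gt0// invrK fG.
have ih : mu.-integrable D (EFin \o (fun x => C^-1 * h x)).
  apply/integrableP; split; last exact: le_lt_trans le_int Goo.
  by apply/measurable_EFinP; exact: measurable_funM.
have ef : ae_eq mu D (fun x => C^-1 * f x) (fun x => C^-1 * h x).
  by apply: filterS fh => x fh Dx; rewrite fh.
have fi : ae_integrable mu D f.
  apply: (@eq_ae_integrable _ _ _ _ _ (fun x => C * (C^-1 * f x))).
    by move=> x _; rewrite mulrA divff ?mul1r// gt_eqF.
  by apply: ae_integrableZ => //; exists (fun x => C^-1 * h x).
split=> //.
rewrite -ler_pdivrMl// -(gtr0_norm (_ : 0 < C^-1)) ?invr_gt0// -normrM.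
rewrite -ae_RintegralZ// (ae_eq_Rintegral ef).
apply: le_trans (le_normr_Rintegral mD ih) _.
apply: fine_le => //.
  exact: (integrable_fin_num mD (integrable_norm ih)).
by rewrite ge0_fin_numE ?integral_ge0.
Qed.

Section bochner_inner.
Context (R : realType) (n : nat) (Omega : smooth_bounded_domain R n).
Local Notation leb := (@lebesgue_measure R).
Local Notation enorm := (@L2enorm R n Omega).
Variables (D : set (measurableTypeR R)) (mD : measurable D) (phi : L2 Omega).
Implicit Types (f : R -> L2 Omega) (s : simple_function enorm).

Lemma inner_sf_fun s t :
  inner (sf_fun s t) phi =
  \sum_(i < sf_size s) inner (sf_val i) phi * \1_(sf_set i) t.
Proof. by rewrite inner_suml; apply: eq_bigr => i _; rewrite innerZl mulrC. Qed.

Lemma measurable_inner_sf_fun s :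
  measurable_fun setT (fun t : measurableTypeR R => inner (sf_fun s t) phi).
Proof.
under eq_fun do rewrite inner_sf_fun.
apply: measurable_sum => i; apply: measurable_funM => //.
by apply: measurable_indic; exact: sf_measurable.
Qed.

Lemma inner_sf_integral s :
  ae_integrable leb D (fun t => inner (sf_fun s t) phi) /\
  \int[leb]_(t in D) inner (sf_fun s t) phi = inner (sf_integral D s) phi.
Proof.
have ind_integrable (i : 'I_(sf_size s)) : true ->
    ae_integrable leb D (\1_(sf_set i) : R -> R).
  move=> _; apply: integrable_ae_integrable.
  apply: (@integrableS _ _ _ _ setT) => //.
  have mi := @sf_measurable _ _ _ s i.
  apply/integrableP; split; first exact/measurable_EFinP/measurable_indic.
  under eq_integral => t _ do rewrite /= ger0_norm ?indicE// -indicE.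
  by rewrite integral_indic// setIT; exact: sf_finite.
under eq_fun do rewrite inner_sf_fun.
have [? ->] := ae_integrable_sum mD (index_enum _)
  (fun i => inner (@sf_val _ _ _ s i) phi) ind_integrable.
split=> //; rewrite inner_suml; apply: eq_bigr => i _.
rewrite innerZl mulrC /Rintegral; congr (fine _ * _).
by rewrite integral_indic//; exact: sf_measurable.
Qed.

(** By Cauchy-Schwarz, the inner products with the approximating simple functions converge wherever
    those functions converge in norm. Multiplying by the indicator of [D] minus a measurable null
    set makes them converge at every point of [D], so that the limit is measurable. *)
Lemma strongly_measurable_inner f : strongly_measurable enorm D f ->
  exists2 h : R -> R, measurable_fun D h & ae_eq leb D (fun t => inner (f t) phi) h.
Proof.
move=> [s [A [mA A0 fA]]].
pose E : set (measurableTypeR R) := D `\` A.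
exists (fun t => \1_E t * inner (f t) phi); last first.
  exists A; split => // t /= /not_implyP[Dt ft]; apply: contrapT => nAt; apply: ft.
  by rewrite indicE mem_set// mul1r.
pose h k (t : measurableTypeR R) := \1_E t * inner (sf_fun (s k) t) phi.
have mh k : measurable_fun D (h k).
  apply: measurable_funS (measurableT) _ _ => //.
  apply: measurable_funM; last exact: measurable_inner_sf_fun.
  by apply: measurable_indic; exact: measurableD.
apply: (measurable_fun_cvg mh) => t Dt.
rewrite /h indicE; have [/set_mem[_ nAt]|tE] := boolP (t \in E); last first.
  by under eq_fun do rewrite mul0r; rewrite mul0r; exact: cvg_cst.
under eq_fun do rewrite mul1r.
rewrite mul1r.
have ft : L2enorm (f t - sf_fun (s k) t) @[k --> \oo] --> 0%E.
  by apply: contrapT => nft; apply: nAt; apply: fA => /(_ Dt).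
apply/subr_cvg0; apply/norm_cvg0P.
move/fine_cvg : ft => /= ft.
apply: (@squeeze_cvgr _ _ _ _ (cst 0)
  (fun k => L2norm (f t - sf_fun (s k) t) * L2norm phi)).
- by apply/nearW => k; rewrite normr_ge0/= distrC -innerBl cauchy_schwarz.
- exact: cvg_cst.
- by rewrite -(mul0r (L2norm phi)); apply: cvgMl.
Qed.

(** For simple functions this is [inner_sf_integral]. In the passage to the limit Cauchy-Schwarz
    bounds the errors by the two sequences that tend to zero in the definition of the integral. *)
Lemma bochner_integral_inner f v : is_bochner_integral enorm D f v ->
  ae_integrable leb D (fun t => inner (f t) phi) /\
  inner v phi = \int[leb]_(t in D) inner (f t) phi.
Proof.
move=> [/strongly_measurable_inner[h mh fh] [s [/fine_cvgP[sfin s0] /fine_cvgP[_ sv0]]]].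
(* The summand 1 keeps the constant positive when [phi] has norm zero. *)
have C0 : 0 < L2norm phi + 1 by rewrite ltr_wpDl ?L2norm_ge0.
pose e k t := inner (f t - sf_fun (s k) t) phi.
have eh k : ae_eq leb D (e k) (fun t => h t - inner (sf_fun (s k) t) phi).
  by apply: filterS fh => t fh Dt; rewrite /e innerBl fh.
have mek k : measurable_fun D (fun t => h t - inner (sf_fun (s k) t) phi).
  by apply: measurable_funB => //; apply: measurable_funTS;
    exact: measurable_inner_sf_fun.
have ek k : D `<=` [set t | `|e k t| <=
    (L2norm phi + 1) * L2norm (f t - sf_fun (s k) t)].
  move=> t _; rewrite /= (le_trans (cauchy_schwarz _ _))// mulrC.
  by rewrite ler_wpM2r ?L2norm_ge0// lerDl.
have dom k := ae_dominated_integrable mD C0 (mek k) (eh k) (@ek k).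
(* A single [k] with a finite error integral suffices: [f] is the error [f - s_k] plus a simple
   function. *)
have fi : ae_integrable leb D (fun t => inner (f t) phi).
  have [k _ /(_ k (leqnn k))] := sfin; rewrite fin_num_abs => kfin.
  have [|ei _] := dom k.
    by apply: le_lt_trans kfin; rewrite lee_abs.
  apply: eq_ae_integrable (ae_integrableD mD ei (inner_sf_integral (s k)).1).
  by move=> t _; rewrite /e innerBl subrK.
split=> //; apply/eqP; rewrite -subr_eq0 -normr_le0.
pose b k := L2norm (sf_integral D (s k) - v) * L2norm phi +
  (L2norm phi + 1) * \int[leb]_(t in D) L2norm (f t - sf_fun (s k) t).
have b0 : b k @[k --> \oo] --> 0.
  rewrite -[X in _ --> X](addr0 0) -{1}(mul0r (L2norm phi)).
  rewrite -[X in _ --> _ + X](mulr0 (L2norm phi + 1)).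
  by apply: cvgD; [apply: cvgMl; exact: sv0|apply: cvgMr; exact: s0].
apply: (cvgr_to_ge b0).
near=> k.
have kfin : (\int[leb]_(t in D) L2enorm (f t - sf_fun (s k) t)%R < +oo)%E.
  have : (\int[leb]_(t in D) L2enorm (f t - sf_fun (s k) t)%R)%E \is a fin_num.
    by near: k.
  by rewrite fin_num_abs; apply: le_lt_trans; rewrite lee_abs.
have [ei le_e] := dom k kfin.
rewrite -(subrK (inner (sf_integral D (s k)) phi) (inner v phi)) -addrA.
apply: le_trans (ler_normD _ _) _; apply: lerD.
  by rewrite distrC -innerBl cauchy_schwarz.
have [si <-] := inner_sf_integral (s k).
apply: le_trans le_e; rewrite distrC -mulN1r -ae_RintegralZ//.
rewrite -ae_RintegralD//; last first.
  exact: ae_integrableZ.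
rewrite le_eqVlt; apply/orP; left; apply/eqP; congr (`| _ |).
by apply: eq_Rintegral => t _; rewrite /e innerBl mulN1r.
Unshelve. all: by end_near. Qed.


Lemma bochner_integrable_inner f : bochner_integrable enorm D f ->
  ae_integrable leb D (fun t => inner (f t) phi).
Proof.
move=> [/strongly_measurable_inner[h mh fh] foo].
have C0 : 0 < L2norm phi + 1 by rewrite ltr_wpDl ?L2norm_ge0.
apply: (ae_dominated_integrable mD C0 mh fh _ foo).1 => t _.
rewrite (le_trans (cauchy_schwarz _ _))// mulrC ler_wpM2r ?L2norm_ge0//.
by rewrite lerDl.
Qed.

End bochner_inner.

(** * Fourier expansions *)

Section fourier.
Context (R : realType) (n : nat) (Omega : smooth_bounded_domain R n).
Variables (lambda : nat -> R) (phi : nat -> L2 Omega).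
Hypothesis basis : dirichlet_eigenbasis lambda phi.
Implicit Types (c : nat -> R) (psi : L2 Omega).

Definition fourier_sum N c : L2 Omega := \sum_(1 <= j < N.+1) c j *: phi j.

Lemma inner_fourier_sum psi N c :
  inner psi (fourier_sum N c) = \sum_(1 <= j < N.+1) c j * inner psi (phi j).
Proof. by rewrite inner_sumr; apply: eq_bigr => j _; rewrite innerZr. Qed.

Lemma fourier_sum_coef N c i : (1 <= i)%N ->
  inner (fourier_sum N c) (phi i) = if (i <= N)%N then c i else 0.
Proof.
move=> i1; rewrite innerC inner_fourier_sum.
have eq j : (1 <= j)%N -> c j * inner (phi i) (phi j) = if i == j then c j else 0.
  by move=> j1; rewrite (eigen_orthonormal basis)//; case: eqP; rewrite ?mulr1 ?mulr0.
rewrite big_nat; under eq_bigr => j /andP[j1 _] do rewrite eq//.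
rewrite -big_nat -big_mkcond/=; case: ifPn => iN.
  rewrite (big_rem i) /= ?mem_index_iota ?i1//= eqxx.
  rewrite big1_seq ?addr0// => j /andP[/eqP <-].
  by rewrite mem_rem_uniq ?iota_uniq// inE eqxx.
rewrite big1_seq// => j /andP[/eqP <-]; rewrite mem_index_iota i1 ltnS.
by rewrite (negbTE iN).
Qed.

Lemma L2norm_fourier_sum_sqr N c :
  L2norm (fourier_sum N c) ^+ 2 = \sum_(1 <= j < N.+1) c j ^+ 2.
Proof.
rewrite L2norm_sqr inner_fourier_sum !big_nat; apply: eq_bigr => j /andP[j1 jN].
by rewrite fourier_sum_coef// -ltnS jN expr2.
Qed.

Lemma eigenvalue_gt0 j : (1 <= j)%N -> 0 < lambda j.
Proof. by move=> j1; rewrite (lt_le_trans (eigen_pos basis))// (eigen_le basis). Qed.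

(** The sum is the inner product of [psi] with the Fourier sum of coefficients
    [c j * expR (lambda j * r)]. Cauchy-Schwarz applies, and as [r] is nonnegative each exponential
    is at most the one at [N]. *)
Lemma fourier_sum_exp_bound N c r psi : 0 <= r ->
  `|\sum_(1 <= j < N.+1) c j * (expR (lambda j * r) * inner psi (phi j))| <=
  expR (lambda N * r) * L2norm (fourier_sum N c) * L2norm psi.
Proof.
move=> r0; pose ce j := c j * expR (lambda j * r).
under eq_bigr => j _ do rewrite mulrA -/(ce j).
rewrite -inner_fourier_sum (le_trans (cauchy_schwarz _ _))// mulrC.
rewrite ler_wpM2r ?L2norm_ge0//.
rewrite -(@ler_pXn2r _ 2)// ?nnegrE ?mulr_ge0 ?L2norm_ge0 ?expR_ge0//.
rewrite exprMn !L2norm_fourier_sum_sqr mulr_sumr !big_nat.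
apply: ler_sum => j /andP[j1 jN]; rewrite /ce exprMn mulrC.
rewrite ler_wpM2r ?sqr_ge0// ler_pXn2r ?nnegrE ?expR_ge0//.
by rewrite ler_expR ler_wpM2r// (eigen_le basis)// j1.
Qed.

Definition fourier_proj N psi := fourier_sum N (fun j => inner psi (phi j)).

(** By completeness [psi] is the limit of its projections of order [M], and the squared distance
    between the projections of orders [M] and [N] is the finite tail in the hypothesis. *)
Lemma L2norm_sub_fourier_proj N B psi : 0 <= B ->
  (forall M, (N <= M)%N -> \sum_(N.+1 <= j < M.+1) inner psi (phi j) ^+ 2 <= B ^+ 2) ->
  L2norm (psi - fourier_proj N psi) <= B.
Proof.
move=> B0 tail; rewrite -subr_le0.
apply: (cvgr_to_ge (eigen_complete basis psi)).
exists N => // M /= NM; rewrite -/(fourier_sum M _) -/(fourier_proj M psi).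
have -> : psi - fourier_proj N psi =
    (psi - fourier_proj M psi) + (fourier_proj M psi - fourier_proj N psi).
  by rewrite addrA subrK.
rewrite lerBlDr (le_trans (ler_L2normD _ _))// lerD2l.
rewrite -(@ler_pXn2r _ 2)// ?nnegrE ?L2norm_ge0//.
apply: le_trans (tail _ NM).
(* The difference of the projections as one Fourier sum, with zero coefficients up to [N]. *)
pose c j := if (N < j)%N then inner psi (phi j) else 0.
suff -> : fourier_proj M psi - fourier_proj N psi = fourier_sum M c.
  rewrite L2norm_fourier_sum_sqr (@big_cat_nat _ _ _ N.+1)//=.
  rewrite big_nat big1 ?add0r; last first.
    by move=> j /andP[_ jN]; rewrite /c ltnNge -ltnS jN/= expr0n.
  by rewrite big_nat [leRHS]big_nat le_eqVlt; apply/orP; left; apply/eqP;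
    apply: eq_bigr => j /andP[Nj _]; rewrite /c Nj.
apply/eqP; rewrite subr_eq addrC /fourier_proj /fourier_sum; apply/eqP.
rewrite (@big_cat_nat _ _ _ N.+1)//=; congr (_ + _).
have c0 : \sum_(1 <= j < N.+1) c j *: phi j = 0.
  rewrite big_nat big1// => j /andP[_ jN].
  by rewrite /c ltnNge -ltnS jN/= scale0r.
rewrite [RHS](@big_cat_nat _ _ _ N.+1)//= c0 add0r.
by rewrite big_nat [RHS]big_nat; apply: eq_bigr => j /andP[Nj _]; rewrite /c Nj.
Qed.

(** The Gevrey weights are nondecreasing in [j], so beyond [N] each squared coefficient times the
    weight at [N] is at most a term of the Gevrey series. *)
Lemma gevrey_tail a b N M (E : R) psi : 0 <= a -> 0 <= b -> (1 <= N <= M)%N ->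
  (gevrey_norm lambda phi a b psi <= E%:E)%E ->
  \sum_(N.+1 <= j < M.+1) inner psi (phi j) ^+ 2 <=
  (lambda N `^ (- a) * expR (- (b * lambda N)) * E) ^+ 2.
Proof.
move=> a0 b0 /andP[N1 NM] normE.
have lN0 := eigenvalue_gt0 N1.
pose wt j := lambda j `^ (2 * a) * expR (2 * b * lambda j).
have wt_ge0 j : 0 <= wt j by rewrite mulr_ge0 ?powR_ge0 ?expR_ge0.
have E0 : 0 <= E by rewrite -lee_fin (le_trans _ normE)// sqrte_ge0.
have term_ge0 j : (0 <= (wt j * `|inner psi (phi j)| ^+ 2)%:E)%E.
  by rewrite lee_fin mulr_ge0 ?sqr_ge0.
have sum_le : \sum_(1 <= j < M.+1) wt j * inner psi (phi j) ^+ 2 <= E ^+ 2.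
  rewrite -lee_fin -sumEFin.
  have := normE; rewrite /gevrey_norm -(gee0_abs (_ : 0 <= E%:E)%E) ?lee_fin//.
  rewrite -sqrte_sqr lee_sqrt; last by rewrite -EFin_expe lee_fin sqr_ge0.
  rewrite -EFin_expe; apply: le_trans.
  under eq_bigr => j _ do rewrite -(real_normK (num_real (inner psi (phi j)))).
  exact: nneseries_lim_ge.
(* The squared prefactor is the reciprocal of the weight at [N]; this is where the exponents [2 * a]
   and [2 * b] become [a] and [b]. *)
have wtN : (lambda N `^ (- a) * expR (- (b * lambda N))) ^+ 2 = (wt N)^-1.
  rewrite exprMn /wt invfM; congr (_ * _).
    by rewrite -powR_mulrn ?powR_ge0// -powRrM mulNr powRN mulrC.
  by rewrite -expRM_natl mulrN expRN mulrA.
rewrite exprMn wtN mulrC ler_pdivlMr; last first.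
  by rewrite mulr_gt0 ?powR_gt0 ?expR_gt0.
apply: le_trans sum_le; rewrite mulr_suml (@big_cat_nat _ _ _ N.+1 1)//= -[leLHS]add0r.
apply: lerD; first by apply: sumr_ge0 => j _; rewrite mulr_ge0 ?sqr_ge0.
rewrite big_nat [leRHS]big_nat; apply: ler_sum => j /andP[Nj _].
have lNj : lambda N <= lambda j by rewrite (eigen_le basis)// N1 ltnW.
rewrite mulrC ler_wpM2r ?sqr_ge0// ler_pM ?powR_ge0 ?expR_ge0//.
  by rewrite ge0_ler_powR ?nnegrE ?mulr_ge0 ?(ltW lN0)// (le_trans (ltW lN0)).
by rewrite ler_expR ler_wpM2l// mulr_ge0.
Qed.

End fourier.

(** * Integrals over intervals *)

Section interval_integrals.
Context (R : realType).
Local Notation leb := (@lebesgue_measure R).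
Implicit Types (a b : R) (f k : R -> R).

(** The endpoints form a null set. Bochner integrals are taken over open intervals, the integrals in
    the coefficient formulas over closed ones. *)
Lemma ae_integrable_oo_cc a b f : ae_integrable leb `]a, b[ f ->
  ae_integrable leb `[a, b] f /\
  \int[leb]_(x in `]a, b[) f x = \int[leb]_(x in `[a, b]) f x.
Proof.
apply: ae_integrable_setD_null => //.
  by move=> x /=; rewrite !in_itv/= => /andP[/ltW -> /ltW ->].
apply/countable_lebesgue_measure0/finite_set_countable.
apply: (@sub_finite_set _ _ [set a; b]); last exact: finite_set2.
move=> x /=; rewrite !in_itv/= => -[/andP[ax xb]] /negP.
by rewrite negb_and -!leNgt => /orP[xa|bx];
  [left|right]; apply/le_anti; rewrite ?ax ?xb ?andbT.
Qed.

Lemma ae_integrableM_continuous a b f k : continuous k ->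
  ae_integrable leb `[a, b] f -> ae_integrable leb `[a, b] (fun x => k x * f x).
Proof.
move=> ck [h ih fh]; exists (fun x => k x * h x); last first.
  by apply: filterS fh => x fh Dx; rewrite fh.
have ck' : {within `[a, b], continuous k} by exact: continuous_subspaceT.
have /compact_bounded[M [Mreal Mk]] :=
  continuous_compact ck' (@segment_compact R a b).
have mab : measurable ([set` `[a, b]] : set (measurableTypeR R)) by [].
have mk : measurable_fun ([set` `[a, b]] : set (measurableTypeR R)) k.
  exact: subspace_continuous_measurable_fun.
have bk : [bounded k x | x in [set` `[a, b]]].
  by exists M; split => // B MB x Dx; apply: (Mk _ MB); exists x.
exact: (integrableMr mab mk bk ih).
Qed.

(** The integral over [[s, b]] is the integral over [[a, b]] minus the one from [a] to [s], which is
    continuous in its upper limit. *)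
Lemma continuous_Rintegral_right a b f : a <= b ->
  leb.-integrable `[a, b] (EFin \o f) ->
  {within `[a, b], continuous (fun s => \int[leb]_(x in `[s, b]) f x)}.
Proof.
move=> ab fi.
have cont := parameterized_integral_continuous ab fi.
have eq : {in `[a, b], (fun s => \int[leb]_(x in `[a, b]) f x
    - parameterized_integral leb a s f) =1 (fun s => \int[leb]_(x in `[s, b]) f x)}.
  move=> s; rewrite in_itv/= => /andP[as_ sb].
  rewrite /parameterized_integral Rintegral_itvB ?bnd_simp//.
  rewrite Rintegral_itv_obnd_cbnd//.
  by apply: integrableS fi => //; apply: subset_itvr; rewrite bnd_simp.
apply: (subspace_eq_continuous (f := fun s => \int[leb]_(x in `[a, b]) f x
    - parameterized_integral leb a s f)).
  by move=> s /set_mem sab; exact: eq.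
by move=> s; apply: cvgB; [exact: cvg_cst|exact: cont].
Qed.

Lemma integrable_itv_continuous a b f : {within `[a, b], continuous f} ->
  leb.-integrable `[a, b] (EFin \o f).
Proof. by apply: continuous_compact_integrable; exact: segment_compact. Qed.

Lemma Rintegral_expR_decay (c t T : R) : 0 < c -> t <= T ->
  \int[leb]_(s in `[t, T]) expR (c * (T - s)) = (expR (c * (T - t)) - 1) / c.
Proof.
(* The fundamental theorem of calculus is applied to a nondegenerate interval, so [t = T] is treated
   apart. *)
move=> c0; rewrite le_eqVlt => /predU1P[->|tT].
  by rewrite set_itv1 Rintegral_set1 subrr mulr0 expR0 subrr mul0r.
pose E s := - c^-1 * expR (c * (T - s)).
have dE (s : R) : is_derive s 1 E (expR (c * (T - s))).
  apply: is_derive_eq.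
  by rewrite /GRing.scale/=; field; rewrite gt_eqF.
have cE : continuous E by move=> x; apply/differentiable_continuous/derivable1_diffP.
rewrite /Rintegral (@continuous_FTC2 _ _ E) //=.
- by rewrite /E subrr mulr0 expR0; field; rewrite gt_eqF.
- apply: continuous_subspaceT => x.
  by apply: (@continuous_comp _ _ _ (fun s => c * (T - s)) expR);
    [apply: cvgMr; apply: cvgB; [exact: cvg_cst|exact: cvg_id]|exact: continuous_expR].
- split; first by move=> x _; have [] := dE x.
  + by apply: cvg_at_right_filter; exact: cE.
  + by apply: cvg_at_left_filter; exact: cE.
- by move=> x _; rewrite derive1E; have [] := dE x.
Qed.

(* The complement of a null set is dense in the interval. *)
Lemma ae_le_continuous (a b C : R) f : a < b -> {within `[a, b], continuous f} ->
  {ae leb, forall x, x \in `]a, b[ -> f x <= C} ->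
  forall x, x \in `[a, b] -> f x <= C.
Proof.
move=> ab /subspace_continuousP cf [A [mA A0 fA]] x xab.
rewrite leNgt; apply/negP => Cfx.
have := cvgr_gt _ (cf x xab) _ Cfx.
rewrite near_withinE => /(_ _) /nbhs_ballP[e /= e0 ef].
(* A neighbourhood of [x] cut down to []a, b[]. On it [f] exceeds [C], so it lies in the null set
   [A]; yet it is nonempty and open, even if [x] is an endpoint. *)
pose I := `]Num.max a (x - e), Num.min b (x + e)[.
move: (xab); rewrite in_itv/= => /andP[ax xb].
have IA : [set` I] `<=` A.
  move=> y; rewrite /= in_itv/= gt_max lt_min => /andP[/andP[ay xey] /andP[yb yxe]].
  apply: fA => /=; rewrite in_itv/= ay yb => /(_ isT); apply/negP; rewrite -ltNge.
  apply: ef; last by rewrite in_itv/= !ltW.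
  by rewrite /ball/= ltr_distlC xey.
have : (leb [set` I] <= 0)%E.
  by rewrite -A0; apply: le_measure; rewrite ?inE//; exact: measurable_itv.
rewrite lebesgue_measure_itv/= lte_fin.
have lt_I : Num.max a (x - e) < Num.min b (x + e).
  by rewrite gt_max !lt_min; apply/andP; split; apply/andP; split; lra.
by rewrite lt_I -EFinB lee_fin subr_le0 leNgt lt_I.
Qed.

End interval_integrals.

(** * Coefficient formulas *)

Section continuity.
Context (R : realType) (n : nat) (Omega : smooth_bounded_domain R n).
Variables (tau : R).
Implicit Types u v : R -> L2 Omega.

Lemma continuous_L2_inner u psi : continuous_L2 tau u ->
  {within `[0, tau], continuous (fun t => inner (u t) psi)}.
Proof.
move=> cu; apply/subspace_continuousP => t tI; apply/subr_cvg0/norm_cvg0P.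
apply: (@squeeze_cvgr _ _ _ _ (cst 0) (fun s => L2norm (u s - u t) * L2norm psi)).
- by apply/nearW => s; rewrite normr_ge0/= -innerBl cauchy_schwarz.
- exact: cvg_cst.
- by rewrite -[X in _ --> X](mul0r (L2norm psi)); apply: cvgMl; exact: cu.
Qed.

Lemma continuous_L2_norm u : continuous_L2 tau u ->
  {within `[0, tau], continuous (fun t => L2norm (u t))}.
Proof.
move=> cu; apply/subspace_continuousP => t tI; apply/subr_cvg0/norm_cvg0P.
apply: (@squeeze_cvgr _ _ _ _ (cst 0) (fun s => L2norm (u s - u t))).
- by apply/nearW => s; rewrite normr_ge0/= ler_L2norm_dist.
- exact: cvg_cst.
- exact: cu.
Qed.

Lemma continuous_L2B u v : continuous_L2 tau u -> continuous_L2 tau v ->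
  continuous_L2 tau (fun t => u t - v t).
Proof.
move=> cu cv t tI.
apply: (@squeeze_cvgr _ _ _ _ (cst 0)
  (fun s => L2norm (u s - u t) + L2norm (v s - v t))).
- apply/nearW => s; rewrite L2norm_ge0/= -(L2normN (v s - v t)).
  rewrite (le_trans _ (ler_L2normD _ _))//.
  by rewrite [- (u t - v t)]opprD addrACA -[- v s - - v t]opprD.
- exact: cvg_cst.
- by rewrite -[X in _ --> X](addr0 0); apply: cvgD; [exact: cu|exact: cv].
Qed.

End continuity.

Section coefficients.
Context (R : realType) (n : nat) (Omega : smooth_bounded_domain R n).
Local Notation leb := (@lebesgue_measure R).
Variables (tau : R) (lambda : nat -> R) (phi : nat -> L2 Omega).
Hypothesis basis : dirichlet_eigenbasis lambda phi.
Variable F : R -> L2 Omega -> L2 Omega.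

Lemma truncated_semigroup_coef N t psi j : (1 <= j)%N ->
  inner (truncated_semigroup lambda phi N t psi) (phi j) =
  if (j <= N)%N then expR (lambda j * t) * inner psi (phi j) else 0.
Proof.
exact: (fourier_sum_coef basis N (fun j => expR (lambda j * t) * inner psi (phi j))).
Qed.

Section regularized.
Variables (g : L2 Omega) (N : nat) (u : R -> L2 Omega).
Hypothesis reg : regularized_solution lambda phi tau F g N u.

(** The data term and both integrands are truncated to the first [N] modes, and inner products pass
    under the Bochner integrals. *)
Lemma regularized_coef_gt j t : (N < j)%N -> t \in `[0, tau] ->
  inner (u t) (phi j) = 0.
Proof.
move=> Nj /reg.2[J [I1 [I2 [_ b1 b2 ut]]]].
have j1 : (1 <= j)%N by apply: leq_trans Nj.
have coef0 s psi : inner (truncated_semigroup lambda phi N s psi) (phi j) = 0.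
  by rewrite truncated_semigroup_coef// leqNgt Nj.
have mI : measurable ([set` `]t, tau[] : set (measurableTypeR R)) by [].
have int0 f I : is_bochner_integral (@L2enorm R n Omega) `]t, tau[
    (fun s => truncated_semigroup lambda phi N (s - t) (f s)) I ->
    inner I (phi j) = 0.
  move=> /(bochner_integral_inner mI (phi j))[_ ->].
  under eq_Rintegral do rewrite coef0.
  by rewrite Rintegral_cst// mul0r.
by rewrite (inner_aeeq _ ut) !innerBl coef0 (int0 _ _ b1) (int0 _ _ b2) !subr0.
Qed.

(** On the retained modes the truncation is invisible, so the coefficients obey the same formula as
    those of the exact solution. Integrability is recorded because subtracting the two formulas
    requires it. *)
Lemma regularized_coef_le j t : (1 <= j <= N)%N -> t \in `[0, tau] ->
  [/\ ae_integrable leb `[t, tau]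
        (fun s => expR (lambda j * (s - t)) * inner (F s (u s)) (phi j)),
      ae_integrable leb `[t, tau] (fun s => expR (lambda j * (s - t)) *
        \int[leb]_(xi in `[s, tau]) inner (u xi) (phi j)) &
      inner (u t) (phi j) =
        expR (lambda j * (tau - t)) * inner g (phi j)
        - \int[leb]_(s in `[t, tau])
            (expR (lambda j * (s - t)) * inner (F s (u s)) (phi j))
        - \int[leb]_(s in `[t, tau])
            (expR (lambda j * (s - t)) *
             \int[leb]_(xi in `[s, tau]) inner (u xi) (phi j))].
Proof.
move=> /andP[j1 jN] /reg.2[J [I1 [I2 [bJ b1 b2 ut]]]].
have coef s psi : inner (truncated_semigroup lambda phi N s psi) (phi j) =
    expR (lambda j * s) * inner psi (phi j).
  by rewrite truncated_semigroup_coef// jN.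
have mI s : measurable ([set` `]s, tau[] : set (measurableTypeR R)) by [].
have int f I : is_bochner_integral (@L2enorm R n Omega) `]t, tau[
    (fun s => truncated_semigroup lambda phi N (s - t) (f s)) I ->
    ae_integrable leb `[t, tau]
      (fun s => expR (lambda j * (s - t)) * inner (f s) (phi j)) /\
    inner I (phi j) = \int[leb]_(s in `[t, tau])
      (expR (lambda j * (s - t)) * inner (f s) (phi j)).
  move=> /(bochner_integral_inner (mI t) (phi j))[/ae_integrable_oo_cc[iI eI] ->].
  have efs : {in [set` `[t, tau]], (fun s => inner (truncated_semigroup lambda phi N
      (s - t) (f s)) (phi j)) =1
      (fun s => expR (lambda j * (s - t)) * inner (f s) (phi j))}.
    by move=> s _; rewrite coef.
  by split; [exact: eq_ae_integrable iI|rewrite eI; exact: eq_Rintegral].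
(* The Bochner integral [J s] enters only through its coefficients, which are scalar integrals. *)
have Jphi : {in [set` `[t, tau]], (fun s => expR (lambda j * (s - t)) *
    inner (J s) (phi j)) =1 (fun s => expR (lambda j * (s - t)) *
        \int[leb]_(xi in `[s, tau]) inner (u xi) (phi j))}.
  move=> s /set_mem sI; congr (_ * _).
  have [/ae_integrable_oo_cc[_ <-] //] := bochner_integral_inner (mI s) (phi j) (bJ s sI).
have [iF eF] := int _ _ b1; have [iJ eJ] := int _ _ b2.
split=> //; first exact: eq_ae_integrable iJ.
rewrite (inner_aeeq _ ut) !innerBl coef eF eJ; congr (_ - _).
exact: eq_Rintegral.
Qed.

End regularized.

(** The coefficient formula of the exact solution does not assert that its integrands are
    integrable. Here this follows from the integrability of [F s (u s)] and the continuity of [u],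
    as continuous weights on a compact interval preserve integrability. *)
Lemma solution_coef_integrable (u : R -> L2 Omega) j t :
  continuous_L2 tau u ->
  bochner_integrable (@L2enorm R n Omega) `]0, tau[ (fun s => F s (u s)) ->
  t \in `[0, tau] ->
  ae_integrable leb `[t, tau]
    (fun s => expR (lambda j * (s - t)) * inner (F s (u s)) (phi j)) /\
  ae_integrable leb `[t, tau] (fun s => expR (lambda j * (s - t)) *
        \int[leb]_(xi in `[s, tau]) inner (u xi) (phi j)).
Proof.
move=> cu iF; rewrite in_itv/= => /andP[t0 tT].
have cexp : continuous (fun s => expR (lambda j * (s - t))).
  move=> s; apply: (@continuous_comp _ _ _ (fun s => lambda j * (s - t)) expR);
    last exact: continuous_expR.
  by apply: cvgMr; apply: cvgB; [exact: cvg_id|exact: cvg_cst].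
have sub : [set` `[t, tau]] `<=` [set` `[0, tau]].
  by apply: subset_itvr; rewrite bnd_simp.
have mI : measurable ([set` `]0, tau[] : set (measurableTypeR R)) by [].
split; apply: ae_integrableM_continuous => //.
  have [[h ih hF] _] := ae_integrable_oo_cc (bochner_integrable_inner mI (phi j) iF).
  exists h; first by apply: integrableS ih.
  by apply: filterS hF => s hF /sub; exact: hF.
apply: integrable_ae_integrable; apply: integrable_itv_continuous.
apply: continuous_Rintegral_right => //.
apply: integrable_itv_continuous; apply: continuous_subspaceW sub _.
exact: continuous_L2_inner.
Qed.

End coefficients.

(** * The error estimate *)

Lemma continuous_expR_decay (R : realType) (c T : R) :
  continuous (fun s => expR (c * (T - s))).
Proof.
move=> s; apply: (@continuous_comp _ _ _ (fun s => c * (T - s)) expR);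
  last exact: continuous_expR.
by apply: cvgMr; apply: cvgB; [exact: cvg_cst|exact: cvg_id].
Qed.

Section error_estimate.
Context (R : realType) (n : nat) (Omega : smooth_bounded_domain R n).
Local Notation leb := (@lebesgue_measure R).
Variables (tau : R) (lambda : nat -> R) (phi : nat -> L2 Omega).
Hypothesis basis : dirichlet_eigenbasis lambda phi.
Variables (F : R -> L2 Omega -> L2 Omega) (kappa : R).
Hypothesis kappa_gt0 : 0 < kappa.
Hypothesis F_lipschitz : forall s, s \in `[0, tau] -> forall psi1 psi2 : L2 Omega,
  L2norm (F s psi1 - F s psi2) <= kappa * L2norm (psi1 - psi2).
Variables (g gdelta : L2 Omega) (delta : R) (u uN : R -> L2 Omega) (N : nat).
Hypothesis g_noise : L2norm (gdelta - g) <= delta.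
Hypothesis u_continuous : continuous_L2 tau u.
Hypothesis Fu_integrable :
  bochner_integrable (@L2enorm R n Omega) `]0, tau[ (fun s => F s (u s)).
Hypothesis u_coef : coefficient_formula lambda phi tau F g u.
Hypothesis uN_reg : regularized_solution lambda phi tau F gdelta N uN.
Hypothesis N_ge1 : (1 <= N)%N.

Let w t := u t - uN t.

(** The decay rate of the comparison function [expR (c * (tau - s))]; it satisfies
    [kappa + c^-1 <= c], which lets both integral terms be absorbed. *)
Let c := 1 + Num.max kappa 1.

Let c_ge2 : 2 <= c. Proof. by rewrite /c -[2]/(1 + 1) lerD2l le_max lexx orbT. Qed.
Let c_gt0 : 0 < c. Proof. by rewrite (lt_le_trans _ c_ge2). Qed.

Let coef_integrable (v : R -> L2 Omega) j s : continuous_L2 tau v -> s \in `[0, tau] ->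
  leb.-integrable `[s, tau] (EFin \o (fun xi => inner (v xi) (phi j))).
Proof.
move=> cv; rewrite in_itv/= => /andP[s0 _].
apply: integrable_itv_continuous.
apply: continuous_subspaceW (continuous_L2_inner (psi := phi j) cv).
by apply: subset_itvr; rewrite bnd_simp.
Qed.

Lemma error_coef j t : (1 <= j <= N)%N -> t \in `[0, tau] ->
  let A s := expR (lambda j * (s - t)) * inner (F s (u s) - F s (uN s)) (phi j) in
  let B s := expR (lambda j * (s - t)) *
    \int[leb]_(xi in `[s, tau]) inner (w xi) (phi j) in
  [/\ ae_integrable leb `[t, tau] A, ae_integrable leb `[t, tau] B &
      inner (w t) (phi j) =
        expR (lambda j * (tau - t)) * inner (g - gdelta) (phi j)
        - \int[leb]_(s in `[t, tau]) A s - \int[leb]_(s in `[t, tau]) B s].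
Proof.
move=> jN tI A B; have /andP[j1 _] := jN.
have [iA2 iB2 e2] := regularized_coef_le basis uN_reg jN tI.
have [iA1 iB1] := solution_coef_integrable lambda phi j u_continuous Fu_integrable tI.
have e1 := u_coef j1 tI.
have mI : measurable ([set` `[t, tau]] : set (measurableTypeR R)) by [].
(* The difference is written with a factor [-1] so that the sum and scaling lemmas apply. *)
have int_sub a b : ae_integrable leb `[t, tau] a -> ae_integrable leb `[t, tau] b ->
    ae_integrable leb `[t, tau] (fun s => a s + -1 * b s) /\
    \int[leb]_(s in `[t, tau]) (a s + -1 * b s) =
    \int[leb]_(s in `[t, tau]) a s - \int[leb]_(s in `[t, tau]) b s.
  move=> ia ib; split; first by apply: ae_integrableD => //; exact: ae_integrableZ.
  rewrite ae_RintegralD//; last exact: ae_integrableZ.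
  by rewrite ae_RintegralZ// mulN1r.
have [iA eA] := int_sub _ _ iA1 iA2.
have [iB eB] := int_sub _ _ iB1 iB2.
have AE : {in [set` `[t, tau]], (fun s =>
    expR (lambda j * (s - t)) * inner (F s (u s)) (phi j) +
    -1 * (expR (lambda j * (s - t)) * inner (F s (uN s)) (phi j))) =1 A}.
  by move=> s _; rewrite /A innerBl; ring.
have BE : {in [set` `[t, tau]], (fun s =>
    expR (lambda j * (s - t)) * \int[leb]_(xi in `[s, tau]) inner (u xi) (phi j) +
    -1 * (expR (lambda j * (s - t)) *
      \int[leb]_(xi in `[s, tau]) inner (uN xi) (phi j))) =1 B}.
  move=> s /set_mem sI; rewrite /B.
  have sI0 : s \in `[0, tau].
    move: tI sI; rewrite /= !in_itv/= => /andP[t0 _] /andP[ts ->].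
    by rewrite (le_trans t0 ts).
  have -> : \int[leb]_(xi in `[s, tau]) inner (w xi) (phi j) =
      \int[leb]_(xi in `[s, tau]) inner (u xi) (phi j) -
      \int[leb]_(xi in `[s, tau]) inner (uN xi) (phi j).
    rewrite -RintegralB//; [|exact: coef_integrable|].
      by apply: eq_Rintegral => xi _; rewrite innerBl.
    by apply: coef_integrable => //; exact: uN_reg.1.
  by ring.
split; [exact: eq_ae_integrable iA|exact: eq_ae_integrable iB|].
have arith (x y1 y2 a1 a2 b1 b2 : R) : x * y1 - a1 - b1 - (x * y2 - a2 - b2) =
    x * (y1 - y2) - (a1 - a2) - (b1 - b2) by ring.
rewrite -(eq_Rintegral leb AE) -(eq_Rintegral leb BE) eA eB.
rewrite (_ : inner (w t) _ = inner (u t) (phi j) - inner (uN t) (phi j)).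
  by rewrite e1 e2 innerBl; exact: arith.
exact: innerBl.
Qed.

(** Pairing the coefficient formula with the coefficients of [w t] produces the square of the
    projected norm, while every bound on the right carries one factor of that norm, which is then
    cancelled. Only scalar integrals occur. *)
Lemma projected_error_bound M t : t \in `[0, tau] -> 0 <= M ->
  (forall s, s \in `[t, tau] ->
    L2norm (w s) <= M * expR (- (lambda N * s)) * expR (c * (tau - s))) ->
  L2norm (fourier_proj phi N (w t)) <=
    expR (lambda N * (tau - t)) * delta +
    expR (- (lambda N * t)) * M * (expR (c * (tau - t)) - 1).
Proof.
move=> tI M0 wM; have /andP[t0 tT] : (0 <= t) && (t <= tau) by rewrite in_itv in tI.
pose cf j := inner (w t) (phi j).
set r := L2norm _; have r0 : 0 <= r by exact: L2norm_ge0.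
pose y s := expR (c * (tau - s)).
have y1 s : s <= tau -> 1 <= y s.
  by move=> sT; rewrite -expR0 ler_expR mulr_ge0 ?subr_ge0// ltW.
have lN0 := eigenvalue_gt0 basis N_ge1.
have iy s : leb.-integrable `[s, tau] (EFin \o y).
  apply: integrable_itv_continuous; apply: continuous_subspaceT.
  exact: continuous_expR_decay.
pose A j s := expR (lambda j * (s - t)) * inner (F s (u s) - F s (uN s)) (phi j).
pose B j s := expR (lambda j * (s - t)) *
  \int[leb]_(xi in `[s, tau]) inner (w xi) (phi j).
(* The range is kept as a predicate since [error_coef] yields integrability for these [j] only. *)
pose P j := (1 <= j < N.+1)%N.
have mI s : measurable ([set` `[s, tau]] : set (measurableTypeR R)) by [].
have iA j : P j -> ae_integrable leb `[t, tau] (A j).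
  by move=> Pj; have [] := error_coef Pj tI.
have iB j : P j -> ae_integrable leb `[t, tau] (B j).
  by move=> Pj; have [] := error_coef Pj tI.
have [iSA eSA] := ae_integrable_sum (mI t) (index_iota 1 N.+1) cf iA.
have [iSB eSB] := ae_integrable_sum (mI t) (index_iota 1 N.+1) cf iB.
have r2 : r ^+ 2 =
    \sum_(1 <= j < N.+1) cf j * (expR (lambda j * (tau - t)) * inner (g - gdelta) (phi j))
    - \int[leb]_(s in `[t, tau]) \sum_(1 <= j < N.+1 | P j) cf j * A j s
    - \int[leb]_(s in `[t, tau]) \sum_(1 <= j < N.+1 | P j) cf j * B j s.
  rewrite eSA eSB (L2norm_fourier_sum_sqr basis) -big_nat.
  rewrite -[X in _ - _ - X]big_nat -!sumrB.
  rewrite big_nat [RHS]big_nat; apply: eq_bigr => j Pj.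
  have [_ _ e] := error_coef Pj tI.
  by rewrite expr2 -/(cf j) {2}/cf e !mulrBr.
(* the weights cancel: [exp(lambda N (s - t)) exp(- lambda N xi)] is at most
   [exp(- lambda N t)] for [s <= xi] *)
have wexp s xi : t <= s -> s <= xi -> xi <= tau ->
    expR (lambda N * (s - t)) * L2norm (w xi) <= expR (- (lambda N * t)) * M * y xi.
  move=> ts sxi xiT.
  have /wM wxi : xi \in `[t, tau] by rewrite in_itv/= xiT (le_trans ts).
  apply: le_trans (ler_wpM2l (expR_ge0 _) wxi) _.
  rewrite -/(y xi) !mulrA ler_wpM2r ?expR_ge0//.
  rewrite mulrAC ler_wpM2r// -expRD ler_expR.
  by rewrite mulrBr addrAC -mulrBr gerDr mulr_ge0_le0 ?(ltW lN0)// subr_le0.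
set K := expR (- (lambda N * t)) * M; have K0 : 0 <= K by rewrite mulr_ge0 ?expR_ge0.
(* The Lipschitz condition contributes [kappa], and integrating [y] over [[t, tau]] contributes
   [(y t - 1) / c]. *)
have sumA : `|\int[leb]_(s in `[t, tau]) \sum_(1 <= j < N.+1 | P j) cf j * A j s| <=
    r * K * kappa * ((y t - 1) / c).
  have iky : leb.-integrable `[t, tau] (EFin \o (fun s => r * K * kappa * y s)).
    by apply: (integrableZl (mI t) (r * K * kappa) (iy t)).
  rewrite -(Rintegral_expR_decay c_gt0 tT) -RintegralZl//.
  apply: ae_le_normr_Rintegral => //; apply: aeW => s sI.
  have /andP[ts sT] : (t <= s) && (s <= tau) by move: sI; rewrite /= in_itv.
  rewrite -big_nat; apply: le_trans (fourier_sum_exp_bound basis _ _ _ _) _.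
    by rewrite subr_ge0.
  rewrite -/(fourier_proj phi N (w t)) -/r mulrAC.
  have sI0 : s \in `[0, tau] by rewrite in_itv/= sT (le_trans t0).
  apply: (@le_trans _ _ (expR (lambda N * (s - t)) * (kappa * L2norm (w s)) * r)).
    by rewrite ler_wpM2r// ler_wpM2l ?expR_ge0// F_lipschitz.
  have := wexp s s ts (lexx _) sT; rewrite -/K => ws.
  have -> : expR (lambda N * (s - t)) * (kappa * L2norm (w s)) * r =
      r * kappa * (expR (lambda N * (s - t)) * L2norm (w s)) by ring.
  have -> : r * K * kappa * expR (c * (tau - s)) = r * kappa * (K * y s).
    by rewrite /y; ring.
  by apply: ler_wpM2l => //; rewrite mulr_ge0 ?(ltW kappa_gt0).
(* The inner integral of [y] is [(y s - 1) / c], hence at most [y s / c]; the outer one gives a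
   second factor [c^-1]. *)
have sumB : `|\int[leb]_(s in `[t, tau]) \sum_(1 <= j < N.+1 | P j) cf j * B j s| <=
    r * K / c * ((y t - 1) / c).
  have iky a s : leb.-integrable `[s, tau] (EFin \o (fun s => a * y s)).
    by apply: (integrableZl (mI s) a (iy s)).
  rewrite -(Rintegral_expR_decay c_gt0 tT) -RintegralZl//.
  apply: ae_le_normr_Rintegral => //.
  apply: aeW => s sI.
  have /andP[ts sT] : (t <= s) && (s <= tau) by move: sI; rewrite /= in_itv.
  have sI0 : s \in `[0, tau] by rewrite in_itv/= sT (le_trans t0).
  have iw j : true -> ae_integrable leb `[s, tau] (fun xi => inner (w xi) (phi j)).
    move=> _; apply: integrable_ae_integrable; apply: coef_integrable => //.
    by apply: continuous_L2B => //; exact: uN_reg.1.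
  (* The weights at time [s] are attached to the coefficients, so that the finite sum moves under
     the inner integral, where [wexp] is used with [s <= xi]. *)
  have [iS eS] := ae_integrable_sum (mI s) (index_iota 1 N.+1)
    (fun j => cf j * expR (lambda j * (s - t))) iw.
  rewrite -big_nat; under eq_bigr => j _ do rewrite /B mulrA.
  rewrite -eS.
  apply: (@le_trans _ _ (\int[leb]_(xi in `[s, tau]) (r * K * y xi))).
    apply: ae_le_normr_Rintegral => //.
    apply: aeW => xi xiI.
    have /andP[sxi xiT] : (s <= xi) && (xi <= tau) by move: xiI; rewrite /= in_itv.
    under eq_bigr => j _ do rewrite -mulrA.
    apply: le_trans (fourier_sum_exp_bound basis _ _ _ _) _.
      by rewrite subr_ge0.
    rewrite -/(fourier_proj phi N (w t)) -/r -mulrA mulrCA -[leRHS]mulrA.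
    by apply: ler_wpM2l => //; exact: wexp.
  rewrite RintegralZl//.
  rewrite Rintegral_expR_decay// -!mulrA ler_wpM2l// ler_wpM2l//.
  by rewrite ler_wpM2l// mulrC ler_wpM2l ?invr_ge0 ?(ltW c_gt0)// lerBlDr lerDl.
have sumX : `|\sum_(1 <= j < N.+1)
    cf j * (expR (lambda j * (tau - t)) * inner (g - gdelta) (phi j))| <=
    r * (expR (lambda N * (tau - t)) * delta).
  apply: le_trans (fourier_sum_exp_bound basis _ _ _ _) _.
    by rewrite subr_ge0.
  rewrite -/(fourier_proj phi N (w t)) -/r -mulrA mulrCA.
  rewrite ler_wpM2l// ler_wpM2l ?expR_ge0//.
  by rewrite -L2normN opprB.
have y_ge1 := y1 _ tT.
(* The choice of [c] pays off here: the two integral terms together stay below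
   [r * K * (y t - 1)]. *)
have kc : (kappa + c^-1) / c <= 1.
  rewrite ler_pdivrMr// mul1r /c addrC; apply: lerD; last by rewrite le_max lexx.
  by rewrite invf_le1 ?c_gt0// (le_trans _ c_ge2)// ler1n.
have r2_le : r * r <= r * (expR (lambda N * (tau - t)) * delta + K * (y t - 1)).
  rewrite -expr2 r2.
  apply: (@le_trans _ _ (r * (expR (lambda N * (tau - t)) * delta) +
      r * K * kappa * ((y t - 1) / c) + r * K / c * ((y t - 1) / c))).
    by move: sumX sumA sumB; rewrite !ler_norml => /andP[_ ?] /andP[? _] /andP[? _]; lra.
  rewrite -addrA [leRHS]mulrDr lerD2l.
  have -> : r * K * kappa * ((y t - 1) / c) + r * K / c * ((y t - 1) / c) =
      r * (K * (y t - 1)) * ((kappa + c^-1) / c) by ring.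
  by rewrite ler_piMr// mulr_ge0// mulr_ge0// subr_ge0.
(* If [r] vanishes it cannot be cancelled, but the bound is nonnegative because [delta] dominates a
   norm. *)
have [r_eq0|r_neq0] := eqVneq r 0.
  rewrite r_eq0 addr_ge0 ?mulr_ge0 ?expR_ge0 ?subr_ge0//.
  by rewrite (le_trans _ g_noise) ?L2norm_ge0.
by move: r2_le; rewrite ler_pM2l// lt_neqAle eq_sym r_neq0.
Qed.

(** [T] collects all that distinguishes the Gevrey classes: [T * expR (- (lambda N * tau))] bounds
    the tail of [u] uniformly in time. *)
Lemma error_bound T t : 0 <= T ->
  (forall s M, s \in `[0, tau] -> (N <= M)%N ->
    \sum_(N.+1 <= j < M.+1) inner (u s) (phi j) ^+ 2 <=
      (T * expR (- (lambda N * tau))) ^+ 2) ->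
  t \in `[0, tau] ->
  L2norm (w t) <= expR (c * (tau - t)) * T * expR (- (lambda N * t)) +
    delta * expR (lambda N * (tau - t)) * expR (c * (tau - t)).
Proof.
move=> T0 tail tI.
have lN0 := eigenvalue_gt0 basis N_ge1.
have tau0 : 0 <= tau by move: tI; rewrite in_itv/= => /andP[]; exact: le_trans.
(* The quotient of the weighted error by the comparison function; it is continuous, so it attains
   its maximum on [[0, tau]]. *)
pose f s := expR (lambda N * s) * expR (- (c * (tau - s))) * L2norm (w s).
have wf s : L2norm (w s) = f s * expR (- (lambda N * s)) * expR (c * (tau - s)).
  rewrite /f !expRN; field.
  by rewrite !gt_eqF ?expR_gt0.
have cf : {within `[0, tau], continuous f}.
  have cw := continuous_L2_norm (continuous_L2B u_continuous uN_reg.1).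
  have ce : {within `[0, tau], continuous
      (fun s => expR (lambda N * s) * expR (- (c * (tau - s))))}.
    apply: continuous_subspaceT => s; apply: cvgM.
      apply: (@continuous_comp _ _ _ (fun s => lambda N * s) expR);
        last exact: continuous_expR.
      by apply: cvgMr; exact: cvg_id.
    apply: (@continuous_comp _ _ _ (fun s => - (c * (tau - s))) expR);
      last exact: continuous_expR.
    by apply: cvgN; apply: cvgMr; apply: cvgB; [exact: cvg_cst|exact: cvg_id].
  by move=> s; apply: cvgM; [exact: ce|exact: cw].
have [m mI fm] := EVT_max tau0 cf.
have fm0 : 0 <= f m by rewrite !mulr_ge0 ?expR_ge0 ?L2norm_ge0.
have /andP[m0 mT] : (0 <= m) && (m <= tau) by rewrite in_itv in mI.
have wM s : s \in `[m, tau] ->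
    L2norm (w s) <= f m * expR (- (lambda N * s)) * expR (c * (tau - s)).
  rewrite in_itv/= => /andP[ms sT].
  rewrite wf !ler_wpM2r ?expR_ge0//; apply: fm.
  by rewrite in_itv/= sT (le_trans m0).
have proj := projected_error_bound mI fm0 wM.
(* Beyond [N] the coefficients of [uN] vanish, so this remainder is the tail of [u]; then [m <= tau]
   weakens the exponential. *)
have rest : L2norm (w m - fourier_proj phi N (w m)) <= T * expR (- (lambda N * m)).
  apply: (L2norm_sub_fourier_proj basis); first by rewrite mulr_ge0 ?expR_ge0.
  move=> M NM.
  apply: (@le_trans _ _ ((T * expR (- (lambda N * tau))) ^+ 2)).
    apply: le_trans (tail m M mI NM); rewrite big_nat [leRHS]big_nat.
    apply: ler_sum => j /andP[Nj _].
    rewrite (_ : inner (w m) _ = inner (u m) (phi j) - inner (uN m) (phi j)).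
      by rewrite (regularized_coef_gt basis uN_reg Nj mI) subr0.
    exact: innerBl.
  rewrite ler_pXn2r ?nnegrE ?mulr_ge0 ?expR_ge0// ler_wpM2l// ler_expR lerN2.
  by rewrite ler_wpM2l// ltW.
(* at the maximum point [m] of [f] the integral inequality reads
   [f m * y <= T + exp(lambda N tau) delta + f m * (y - 1)] with
   [y = exp(c (tau - m))] *)
have max_le : f m <= T + expR (lambda N * tau) * delta.
  have := le_trans (ler_L2normD (w m - fourier_proj phi N (w m))
    (fourier_proj phi N (w m))) (lerD rest proj).
  rewrite subrK wf.
  have -> : lambda N * (tau - m) = lambda N * tau - lambda N * m by rewrite mulrBr.
  rewrite [expR (lambda N * tau - _)]expRD => le1.
  rewrite -(ler_pM2r (expR_gt0 (- (lambda N * m)))).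
  by lra.
rewrite wf; apply: (@le_trans _ _ ((T + expR (lambda N * tau) * delta) *
    expR (- (lambda N * t)) * expR (c * (tau - t)))).
  by rewrite !ler_wpM2r ?expR_ge0// (le_trans (fm _ tI)).
rewrite [lambda N * (tau - t)]mulrBr [expR (lambda N * tau - _)]expRD.
by rewrite le_eqVlt; apply/orP; left; apply/eqP; ring.
Qed.

End error_estimate.

(** * Tail bounds at every time from the essential supremum of the Gevrey norm *)

Section gevrey.
Context (R : realType) (n : nat) (Omega : smooth_bounded_domain R n).
Variables (tau : R) (lambda : nat -> R) (phi : nat -> L2 Omega).
Hypothesis tau_gt0 : 0 < tau.
Hypothesis basis : dirichlet_eigenbasis lambda phi.
Variables (a b : R) (u : R -> L2 Omega).
Hypotheses (a_ge0 : 0 <= a) (b_ge0 : 0 <= b).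
Hypothesis u_continuous : continuous_L2 tau u.
Hypothesis u_gevrey : in_Linf_gevrey lambda phi tau a b u.
Local Notation leb := (@lebesgue_measure R).

(** An essential supremum of nonnegative values is nonnegative once the measure is nonzero; here its
    total mass is [tau]. *)
Lemma Linf_gevrey_norm_ge0 : 0 <= Linf_gevrey_norm lambda phi tau a b u.
Proof.
have tau_mrestr : mrestr leb (@measurable_itv R `]0, tau[) setT = tau%:E.
  transitivity (leb `]0, tau[); first by congr (leb _); exact: setTI.
  by rewrite lebesgue_measure_itv/= lte_fin tau_gt0 sube0.
apply/fine_ge0/ess_sup_gee; last by apply: aeW => t; exact: sqrte_ge0.
by have := tau_gt0; rewrite -lte_fin -tau_mrestr.
Qed.

(** The essential supremum controls the Gevrey norm only for almost every [t]. A finite tail sum is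
    continuous in [t], so its bound extends to all of [[0, tau]]; this is why tails are cut at
    [M]. *)
Lemma Linf_gevrey_tail N M t : (1 <= N <= M)%N -> t \in `[0, tau] ->
  \sum_(N.+1 <= j < M.+1) inner (u t) (phi j) ^+ 2 <=
  (lambda N `^ (- a) * expR (- (b * lambda N)) *
    Linf_gevrey_norm lambda phi tau a b u) ^+ 2.
Proof.
move=> NM; move: t; apply: ae_le_continuous => //.
  have cu j := continuous_L2_inner (psi := phi j) u_continuous.
  elim: (index_iota _ _) => [|j r IH].
    rewrite (_ : (fun x => _) = cst 0); last by apply/funext => x; rewrite big_nil.
    by move=> x; exact: cvg_cst.
  rewrite (_ : (fun x => _) = (fun x => inner (u x) (phi j) * inner (u x) (phi j) +
      \sum_(i <- r) inner (u x) (phi i) ^+ 2)).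
    by move=> x; apply: cvgD; [apply: cvgM; exact: cu|exact: IH].
  by apply/funext => x; rewrite big_cons.
have := ess_sup_ge (mrestr leb (@measurable_itv R `]0, tau[))
  (fun t => gevrey_norm lambda phi a b (u t)).
move=> [A [mA A0 uA]].
(* [A] is null for the restricted measure, which says that its part inside []0, tau[] is Lebesgue
   null. *)
exists (A `&` `]0, tau[); split => //; first exact: measurableI.
move=> t /= /not_implyP[tI nle]; split=> //; apply: uA => /= le_norm; apply: nle.
apply: (gevrey_tail basis a_ge0 b_ge0 NM).
rewrite /Linf_gevrey_norm fineK// fin_real// u_gevrey.2 andbT.
by rewrite (lt_le_trans ltNy0)// (le_trans _ le_norm)// sqrte_ge0.
Qed.

End gevrey.

(** Both estimates are instances of [error_bound]: [T] is the Gevrey norm times [lambda N] to the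
    power [- p] in the first, and the Gevrey norm times [expR (- (q * lambda N))] in the second. The
    remaining factor [expR (- (lambda N * tau))] of the tail comes from the [tau] in the Gevrey
    index. *)
Theorem theorem4p3 (R : realType) (d : nat) (d_ge1 : (1 <= d)%N)
  (Omega : smooth_bounded_domain R d) (tau : R) (tau_gt0 : 0 < tau)
  (lambda : nat -> R) (phi : nat -> L2 Omega)
  (basis : dirichlet_eigenbasis lambda phi)
  (F : R -> L2 Omega -> L2 Omega)
  (kappa : R) (kappa_gt0 : 0 < kappa)
  (F_lipschitz : forall s, s \in `[0, tau] -> forall psi1 psi2 : L2 Omega,
    L2norm (F s psi1 - F s psi2) <= kappa * L2norm (psi1 - psi2))
  (F_integrable : exists psi0 : L2 Omega,
    bochner_integrable (@L2enorm R d Omega) `]0, tau[ (fun s => F s psi0))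
  (g : L2 Omega) (u : R -> L2 Omega)
  (u_solution : unique_in_CL2 tau (fvp_solution tau F g) u)
  (u_coefficients : coefficient_formula lambda phi tau F g u)
  (delta : R) (delta_gt0 : 0 < delta)
  (gdelta : L2 Omega) (g_noise : L2norm (gdelta - g) <= delta)
  (p q : R) (p_gt0 : 0 < p) (q_gt0 : 0 < q)
  (N : nat) (N_ge1 : (1 <= N)%N) (uN : R -> L2 Omega)
  (uN_solution :
    unique_in_CL2 tau (regularized_solution lambda phi tau F gdelta N) uN) :
  let kappa0 := Num.max kappa 1 in
  (in_Linf_gevrey lambda phi tau p tau u ->
   forall t, t \in `[0, tau] ->
   L2norm (u t - uN t) <=
     expR ((1 + kappa0) * (tau - t)) * Linf_gevrey_norm lambda phi tau p tau u
       * lambda N `^ (- p) * expR (- (lambda N * t))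
     + delta * expR (lambda N * (tau - t)) * expR ((1 + kappa0) * (tau - t)))
  /\
  (in_Linf_gevrey lambda phi tau 0 (q + tau) u ->
   forall t, t \in `[0, tau] ->
   L2norm (u t - uN t) <=
     expR ((1 + kappa0) * (tau - t))
       * Linf_gevrey_norm lambda phi tau 0 (q + tau) u
       * expR (- ((q + t) * lambda N))
     + delta * expR (lambda N * (tau - t)) * expR ((1 + kappa0) * (tau - t))).
Proof.
move=> kappa0.
have [[u_cont Fu_int _ _] _] := u_solution.
have bound := error_bound basis kappa_gt0 F_lipschitz g_noise u_cont Fu_int
  u_coefficients uN_solution.1 N_ge1.
split=> [up|uq] t tI.
- rewrite -(mulrA (expR _) (Linf_gevrey_norm _ _ _ _ _ _)).
  apply: bound => //.
    by rewrite mulr_ge0 ?powR_ge0// Linf_gevrey_norm_ge0.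
  move=> s M sI NM.
  rewrite mulrAC mulrC [_ * expR _]mulrC [lambda N * tau]mulrC mulrA.
  apply: (Linf_gevrey_tail tau_gt0 basis (ltW p_gt0) (ltW tau_gt0)) => //.
  by rewrite N_ge1.
- rewrite (mulrDl q t) [- (q * _ + _)]opprD [expR (- (q * _) - _)]expRD mulrA.
  rewrite -(mulrA (expR _) (Linf_gevrey_norm _ _ _ _ _ _)).
  rewrite [t * _]mulrC.
  apply: bound => //.
    by rewrite mulr_ge0 ?expR_ge0// Linf_gevrey_norm_ge0.
  move=> s M sI NM.
  have NM1 : (1 <= N <= M)%N by rewrite N_ge1.
  have := Linf_gevrey_tail tau_gt0 basis (lexx 0)
    (addr_ge0 (ltW q_gt0) (ltW tau_gt0)) u_cont uq NM1 sI.
  by rewrite oppr0 powRr0 mul1r (mulrDl q tau) opprD expRD mulrC mulrA [tau * _]mulrC.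
Qed.
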